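(* Let $n\ge 2$. A function $\mathrm{z}:\mathcal{P}(\mathbb{Z}^n)\to\mathbb{R}^n$ is $\mathrm{SL}_n(\mathbb{Z})$ and translation equivariant and additive if and only if $\mathrm{z}=\ell_1$.
   Context: $\mathcal{P}(\mathbb{Z}^n)$ is the set of lattice polytopes, i.e. convex hulls of finite non-empty subsets of $\mathbb{Z}^n$. A function $\mathrm{z}:\mathcal{P}(\mathbb{Z}^n)\to\mathbb{R}^n$ is additive if $\mathrm{z}(P+Q)=\mathrm{z}(P)+\mathrm{z}(Q)$ for all $P,Q\in\mathcal{P}(\mathbb{Z}^n)$, where $P+Q=\{x+y:x\in P,\,y\in Q\}$ is the Minkowski sum. $\mathrm{SL}_n(\mathbb{Z})$ is the group of integer $n\times n$ matrices of determinant $1$. $\mathrm{z}$ is $\mathrm{SL}_n(\mathbb{Z})$ equivariant if $\mathrm{z}(\phi P)=\phi\,\mathrm{z}(P)$ for all $\phi\in\mathrm{SL}_n(\mathbb{Z})$ and $P\in\mathcal{P}(\mathbb{Z}^n)$; it is translation equivariant if $\mathrm{z}(P+x)=\mathrm{z}(P)+x$ for all $x\in\mathbb{Z}^n$ and $P\in\mathcal{P}(\mathbb{Z}^n)$. Discrete Steiner point: for $P\in\mathcal{P}(\mathbb{Z}^n)$ let $\ell(P)=\sum_{x\in P\cap\mathbb{Z}^n}x$. By a theorem of McMullen, there are $\ell_i(P)\in\mathbb{Q}^n$, $i=1,\dots,n+1$, with $\ell(kP)=\sum_{i=1}^{n+1}\ell_i(P)k^i$ for all $k\in\mathbb{N}$.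 The coefficient $\ell_1(P)$ of $k$ is the discrete Steiner point of $P$. *)

(* Defs.v *)
From mathcomp Require Export all_boot all_order all_algebra.
From mathcomp Require Export all_classical all_reals.
From mathcomp Require Export interval_inference convex.

Set Implicit Arguments.
Unset Strict Implicit.
Unset Printing Implicit Defensive.

Import Order.TTheory GRing.Theory Num.Theory.

Local Open Scope classical_set_scope.
Local Open Scope ring_scope.

Section Hull.
Context {R : realType} {n : nat}.
Implicit Types A B : set 'cV[R]_n.

Definition convex_hull A : set 'cV[R]_n := smallest (@convex_set R 'cV[R]_n) A.

Lemma convexP A : @convex_set R 'cV[R]_n A <->
  forall x y (t : R), 0 <= t -> t <= 1 -> A x -> A y -> A (t *: x + (1 - t) *: y).
Proof.
split=> [cA x y t t0 t1 Ax Ay|cA x y t].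
  have t01 : Itv.spec (@Itv.num_sem R) (Itv.Real `[0%Z, 1%Z]) t.
    by apply/and3P; split; rewrite ?realE ?t0 ?bnd_simp //= in_itv /= t0 t1.
  by have := cA x y (Itv.mk t01); rewrite !inE; apply.
rewrite !inE => Ax Ay.
by have := cA x y t%:num; apply.
Qed.

Lemma convex_hullP A x y (t : R) : 0 <= t -> t <= 1 ->
  convex_hull A x -> convex_hull A y -> convex_hull A (t *: x + (1 - t) *: y).
Proof.
move=> t0 t1 Ax Ay B [/[dup] cB /convexP cB' AB].
by apply: cB' => //; [apply: Ax|apply: Ay].
Qed.

Definition affine_map (f : 'cV[R]_n -> 'cV[R]_n) :=
  forall x y (t : R), f (t *: x + (1 - t) *: y) = t *: f x + (1 - t) *: f y.

Lemma convex_hull_image (f : 'cV[R]_n -> 'cV[R]_n) A :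
  affine_map f -> f @` convex_hull A = convex_hull (f @` A).
Proof.
move=> ff; apply/seteqP; split.
  suff : convex_hull A `<=` f @^-1` convex_hull (f @` A).
    by move=> sA _ [x Ax <-]; apply: sA.
  apply: smallest_sub => [|x Ax]; last by apply: sub_gen_smallest; exists x.
  apply/convexP => x y t t0 t1 Ax Ay; rewrite /preimage /= ff.
  exact: convex_hullP.
apply: smallest_sub => [|_ [x Ax <-]].
  apply/convexP => _ _ t t0 t1 [x Ax <-] [y Ay <-].
  exists (t *: x + (1 - t) *: y); last exact: ff.
  exact: convex_hullP.
by exists x => //; exact: sub_gen_smallest.
Qed.

Definition minkowski_sum A B : set 'cV[R]_n := [set x + y | x in A & y in B].

Lemma convex_hull_minkowski_sum A B :
  minkowski_sum (convex_hull A) (convex_hull B) = convex_hull (minkowski_sum A B).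
Proof.
have convD (t : R) (x y b : 'cV[R]_n) :
    t *: x + (1 - t) *: y + b = t *: (x + b) + (1 - t) *: (y + b).
  by rewrite !scalerDr addrACA -scalerDl [t + _]addrC subrK scale1r.
apply/seteqP; split.
  have hB a : A a -> convex_hull B `<=` [set b | convex_hull (minkowski_sum A B) (a + b)].
    move=> Aa; apply: smallest_sub => [|b Bb].
      by apply/convexP => x y t t0 t1 /= Ax Ay; rewrite addrC convD ![_ + a]addrC; apply: convex_hullP.
    by apply: sub_gen_smallest; exists a => //; exists b.
  move=> _ [a hAa [b hBb <-]]; move: a hAa.
  apply: (@smallest_sub _ _ _ [set a | convex_hull (minkowski_sum A B) (a + b)]).
    by apply/convexP => x y t t0 t1 /= Ax Ay; rewrite convD; apply: convex_hullP.
  by move=> a Aa; apply: hB.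
apply: smallest_sub => [|_ [a Aa [b Bb <-]]].
  apply/convexP => _ _ t t0 t1 [a Aa [b Bb <-]] [a' Aa' [b' Bb' <-]].
  exists (t *: a + (1 - t) *: a'); first exact: convex_hullP.
  exists (t *: b + (1 - t) *: b'); first exact: convex_hullP.
  by rewrite !scalerDr addrACA.
by exists a; [exact: sub_gen_smallest|exists b => //; exact: sub_gen_smallest].
Qed.

End Hull.

Section LatticePolytopes.
Context {R : realType} {n : nat}.

Definition lattice_vec (x : 'cV[int]_n) : 'cV[R]_n := map_mx intr x.

Definition is_lattice_polytope (P : set 'cV[R]_n) :=
  exists S : set 'cV[int]_n,
    [/\ finite_set S, S !=set0 & P = convex_hull (lattice_vec @` S)].

Lemma is_lattice_polytope_image (f : 'cV[R]_n -> 'cV[R]_n)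
    (g : 'cV[int]_n -> 'cV[int]_n) P :
  affine_map f -> (forall x, f (lattice_vec x) = lattice_vec (g x)) ->
  is_lattice_polytope P -> is_lattice_polytope (f @` P).
Proof.
move=> ff fg [S [finS [x Sx] ->]]; exists (g @` S); split.
- exact: finite_image.
- by exists (g x); exists x.
- rewrite convex_hull_image //; congr convex_hull.
  by rewrite !image_comp; apply: eq_imagel => y _; exact: fg.
Qed.

Lemma is_lattice_polytope_sum P Q :
  is_lattice_polytope P -> is_lattice_polytope Q ->
  is_lattice_polytope (minkowski_sum P Q).
Proof.
move=> [S [finS [x Sx] ->]] [T [finT [y Ty] ->]].
exists [set a + b | a in S & b in T]; split.
- exact: finite_image2.
- by exists (x + y); exists x => //; exists y.
- rewrite convex_hull_minkowski_sum; congr convex_hull; apply/seteqP; split.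
    move=> _ [_ [a Sa <-] [_ [b Tb <-] <-]]; exists (a + b).
      by exists a => //; exists b.
    by rewrite /lattice_vec map_mxD.
  move=> _ [_ [a Sa [b Tb <-]] <-]; exists (lattice_vec a); first by exists a.
  by exists (lattice_vec b); [exists b|rewrite /lattice_vec map_mxD].
Qed.

End LatticePolytopes.

Record lattice_polytope (R : realType) (n : nat) := LatticePolytope {
  polytope_set :> set 'cV[R]_n;
  polytope_setP : is_lattice_polytope polytope_set }.

Section Operations.
Context {R : realType} {n : nat}.
Implicit Types P Q : lattice_polytope R n.

Lemma lattice_polytope_inj P Q : P = Q :> set 'cV[R]_n -> P = Q.
Proof.
by case: P Q => [P hP] [Q hQ] /= PQ; subst Q; rewrite (Prop_irrelevance hP hQ).
Qed.

Definition polytope_add P Q : lattice_polytope R n :=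
  LatticePolytope (is_lattice_polytope_sum (polytope_setP P) (polytope_setP Q)).

Lemma polytope_mulmx_subproof (phi : 'M[int]_n) P :
  is_lattice_polytope ((fun x : 'cV[R]_n => map_mx intr phi *m x) @` P).
Proof.
apply: (is_lattice_polytope_image (g := mulmx phi)) (polytope_setP P).
  by move=> x y t; rewrite mulmxDr -!scalemxAr.
by move=> x; rewrite /lattice_vec map_mxM.
Qed.

Definition polytope_mulmx (phi : 'M[int]_n) P : lattice_polytope R n :=
  LatticePolytope (polytope_mulmx_subproof phi P).

Lemma polytope_translate_subproof P (v : 'cV[int]_n) :
  is_lattice_polytope ((fun x : 'cV[R]_n => x + lattice_vec v) @` P).
Proof.
apply: (is_lattice_polytope_image (g := fun x => x + v)) (polytope_setP P).
  move=> x y t.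
  by rewrite !scalerDr addrACA -scalerDl [t + _]addrC subrK scale1r.
by move=> x; rewrite /lattice_vec map_mxD.
Qed.

Definition polytope_translate P (v : 'cV[int]_n) : lattice_polytope R n :=
  LatticePolytope (polytope_translate_subproof P v).

Lemma polytope_dilate_subproof (k : nat) P :
  is_lattice_polytope ((fun x : 'cV[R]_n => k%:R *: x) @` P).
Proof.
apply: (is_lattice_polytope_image (g := fun x => k%:R *: x)) (polytope_setP P).
  by move=> x y t; rewrite scalerDr !scalerA ![_ * k%:R]mulrC.
by move=> x; apply/matrixP => i j; rewrite !mxE rmorphM /= rmorph_nat.
Qed.

Definition polytope_dilate (k : nat) P : lattice_polytope R n :=
  LatticePolytope (polytope_dilate_subproof k P).

End Operations.

Section DiscreteSteinerPoint.
Context {R : realType} {n : nat}.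
Implicit Type P : lattice_polytope R n.

Definition lattice_points P : set 'cV[int]_n := [set x | polytope_set P (lattice_vec x)].

Lemma finite_lattice_points P : finite_set (lattice_points P).
Proof.
have [S [finS _ PE]] := polytope_setP P; rewrite /lattice_points PE => {PE}.
have [M HM] : exists M : nat, forall x i, S x -> `|x i 0| <= M%:Z.
  have /finite_seqP[s sE] := finS.
  exists (\sum_(x <- s) \sum_i absz (x i 0%R))%N => x i; rewrite sE /= => xs.
  by rewrite -abszE lez_nat (big_rem x) //= (bigD1 i) //= -addnA leq_addr.
have hull : convex_hull (lattice_vec @` S) `<=`
    [set v : 'cV[R]_n | forall i, `|v i 0| <= M%:R].
  apply: smallest_sub => [|_ [x Sx <-] i].
    apply/convexP => x y t t0 t1 /= hx hy i; rewrite !mxE.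
    apply: (le_trans (ler_normD _ _)); rewrite !normrM (ger0_norm t0).
    rewrite (@ger0_norm _ (1 - t)) ?subr_ge0 //.
    have -> : M%:R = t * M%:R + (1 - t) * M%:R :> R by rewrite -mulrDl [t + _]addrC subrK mul1r.
    by apply: lerD; apply: ler_wpM2l => //; rewrite subr_ge0.
  by rewrite mxE -intr_norm -[leRHS]/(M%:~R) ler_int HM.
apply: (@sub_finite_set _ _ ((fun m : 'cV['I_(M + M).+1]_n =>
    map_mx (fun j : 'I_(M + M).+1 => (j : nat)%:Z - M%:Z) m) @` setT)); last first.
  by apply: finite_image; exact: finite_finset.
move=> x /= /hull hx.
have {}hx i : `|x i 0| <= M%:Z.
  by have := hx i; rewrite mxE -intr_norm -[leRHS]/(M%:~R) ler_int.
exists (map_mx (fun z : int => inord (absz (z + M%:Z))) x) => //.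
apply/matrixP => i j; rewrite !mxE ord1.
move: (hx i); rewrite ler_norml => /andP[h1 h2].
have h0 : 0 <= x i 0 + M%:Z by rewrite -lerBlDr sub0r.
rewrite inordK; first by rewrite gez0_abs // addrK.
by rewrite ltnS -lez_nat gez0_abs // PoszD lerD2r.
Qed.

(* \sum_(x \in A) is 0 on an infinite support, which finite_lattice_points
   excludes. *)
Definition lattice_sum P : 'cV[int]_n := \sum_(x \in lattice_points P) x.

Definition ehrhart_expansion P (c : nat -> 'cV[rat]_n) :=
  forall k : nat, map_mx intr (lattice_sum (polytope_dilate k P)) =
    \sum_(1 <= i < n.+2) k%:R ^+ i *: c i.

(* An expansion exists by a theorem of McMullen, and determines its
   coefficients (ehrhart_coefE); the default 0 of xget is never used. *)
Definition ehrhart_coef P (i : nat) : 'cV[rat]_n :=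
  xget 0 [set c i | c in ehrhart_expansion P].

Definition discrete_steiner_point P : 'cV[R]_n :=
  map_mx ratr (ehrhart_coef P 1).

Lemma ehrhart_expansion_unique P c d i : ehrhart_expansion P c ->
  ehrhart_expansion P d -> (1 <= i < n.+2)%N -> c i = d i.
Proof.
move=> hc hd ilt; apply/matrixP => r s; rewrite ord1 => {s}.
pose p := \poly_(j < n.+2) (if j == 0 then 0 else (c j - d j) r 0).
have p0 : p = 0.
  apply: (@roots_geq_poly_eq0 _ _ [seq k%:R | k <- iota 0 n.+2]).
  - apply/allP => _ /mapP[k _ ->]; rewrite /root horner_poly.
    have /matrixP/(_ r 0) := etrans (esym (hc k)) (hd k).
    move/eqP; rewrite -subr_eq0 => /eqP; rewrite !summxE -sumrB => kE.
    rewrite big_ord_recl /= mul0r add0r -[X in _ == X]kE big_add1 big_mkord.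
    by apply/eqP/eq_bigr => j _; rewrite /bump /= add1n !mxE mulrBl ![_ * k%:R ^+ _]mulrC.
  - by rewrite map_inj_uniq ?iota_uniq // => a b /eqP; rewrite eqr_nat => /eqP.
  - by rewrite size_map size_iota size_poly.
have /eqP : p`_i = 0 by rewrite p0 coef0.
case/andP: ilt => i0 ilt; rewrite coef_poly ilt gtn_eqF // !mxE subr_eq0.
by move/eqP.
Qed.

Lemma ehrhart_coefE P c i : ehrhart_expansion P c ->
  (1 <= i < n.+2)%N -> ehrhart_coef P i = c i.
Proof.
move=> hc ilt; apply: xget_unique; first by exists c.
by move=> _ [d hd <-]; exact: ehrhart_expansion_unique hd hc ilt.
Qed.

End DiscreteSteinerPoint.

Section Properties.
Context {R : realType} {n : nat}.
Implicit Type z : lattice_polytope R n -> 'cV[R]_n.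

Definition SLZ_equivariant z := forall (phi : 'M[int]_n) P,
  \det phi = 1 -> z (polytope_mulmx phi P) = map_mx intr phi *m z P.

Definition translation_equivariant z := forall (x : 'cV[int]_n) P,
  z (polytope_translate P x) = z P + lattice_vec x.

Definition minkowski_additive z := forall P Q,
  z (polytope_add P Q) = z P + z Q.

End Properties.

(* Main.v *)
Require Import Defs.
From HB Require Import structures.
From mathcomp Require Import ring lra.

Set Implicit Arguments.
Unset Strict Implicit.
Unset Printing Implicit Defensive.

Import Order.TTheory GRing.Theory Num.Theory.

Local Open Scope classical_set_scope.
Local Open Scope ring_scope.

(** Both directions rest on alternating sums over the sublists of a finite list.

    _The discrete Steiner point has the three properties._  Let P be the convex
    hull of m lattice points v_i, and K another lattice polytope.  The
    indicator functions of lattice polytopes satisfy, with S running through the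
    sets of indices,
      sum over S of (-1)^|S| [K + (k - |S|) P + sum_(i in S) v_i] = 0   (k >= m)
    ([indicator_relation]).  Indeed, at a point x this is the Euler
    characteristic of the nerve of a cover of a convex set: the coefficient
    vectors c >= 0 with sum k for which x - sum c_i v_i lies in K are covered by
    the half-spaces c_i >= 1, because their coordinates add up to at least m
    ([nerve]).  Summing 1, respectively x, over the lattice points x turns the
    relation into a finite difference equation: the m-th differences of the
    number of lattice points of K + kP vanish, and so do the (m+1)-st differences
    of the sum of these lattice points.  By Newton's formula both are polynomials
    in k; this holds from k = 0 on, so their constant terms are read off at
    k = 0, and the trivial bound on the size of kP limits the degree to n + 1.
    Hence the expansion defining l_1 exists.  Translation by t adds k t times
    the number of lattice points of kP, whose constant term is 1, so l_1 moves by
    t.  Moreover l(aP + bQ) is a finite sum of products of a polynomial in a and a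
    polynomial in b; the linear term along the diagonal a = b is the sum of the
    linear terms along the two axes, and this is additivity.

    _Uniqueness._  The difference w of two such functions is additive, SL_n(Z)
    equivariant and translation invariant, and has to vanish.  An additive
    function depends only on support functions: a linear relation between support
    functions of lattice polytopes is an equality of two Minkowski sums, by
    separation of a point from a polytope ([gordan], [separation]).  The support
    function of a convex hull is a maximum, and maxima satisfy an alternating
    identity ([alt_foldr_max]); hence, whenever the convex hulls of A and B
    meet, the alternating sum of w(conv(S ++ B)) over the sublists S of A is 0
    ([radon_relation]).  One inducts on the number of points.  If the points
    are affinely dependent, Radon's theorem supplies A and B, and w of their hull is
    expressed by hulls of fewer points.  If they are the vertices v_i of a
    simplex which is not unimodular, there is a lattice point x = sum l_i v_i
    with sum l_i = 1 and all |l_i| < 1; exchanging v_i for x multiplies the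
    Gram determinant by l_i^2 < 1, and the two Radon relations among the v_i
    and x express w of the simplex by hulls of fewer points or of smaller Gram
    determinant.  There remain the unimodular simplices, whose affine symmetries
    in SL_n(Z) and shears have no common nonzero fixed vector ([hull_unimodular]). *)

(** * Alternating sums over sublists *)

(** In closed form the sum of (-1)^|S| phi S over the sublists S of s, taken by
    position: equal sublists at different positions count separately. *)
Fixpoint alt (I : Type) (V : zmodType) (s : seq I) (phi : seq I -> V) : V :=
  if s is i :: s' then alt s' phi - alt s' (fun S => phi (i :: S)) else phi [::].

Section Alternating.
Variables (I : eqType) (V : zmodType).
Implicit Types (s S : seq I) (phi psi : seq I -> V).

Lemma eq_alt s phi psi :
  (forall S, subseq S s -> phi S = psi S) -> alt s phi = alt s psi.
Proof.
elim: s phi psi => [|i s IHs] phi psi eq_phi /=; first exact: eq_phi.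
congr (_ - _); apply: IHs => S sSs; apply: eq_phi.
  exact: subseq_trans sSs (subseq_cons _ _).
by rewrite /= eqxx.
Qed.

Lemma altB s phi psi : alt s (fun S => phi S - psi S) = alt s phi - alt s psi.
Proof.
elim: s phi psi => [|i s IHs] phi psi //=.
by rewrite !IHs !opprD addrACA.
Qed.

Lemma alt0 s : alt s (fun=> 0) = 0 :> V.
Proof. by elim: s => //= i s ->; rewrite subrr. Qed.

Lemma altD s phi psi : alt s (fun S => phi S + psi S) = alt s phi + alt s psi.
Proof.
elim: s phi psi => [|i s IHs] phi psi //=.
by rewrite !IHs opprD addrACA.
Qed.

Lemma alt_sum (J : Type) (r : seq J) s (phi : J -> seq I -> V) :
  alt s (fun S => \sum_(j <- r) phi j S) = \sum_(j <- r) alt s (phi j).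
Proof.
elim: r => [|j r IHr].
  by rewrite big_nil -[RHS](alt0 s); apply: eq_alt => S _; rewrite big_nil.
by rewrite big_cons -IHr -altD; apply: eq_alt => S _; rewrite big_cons.
Qed.

Lemma alt_full s phi :
  (forall S, subseq S s -> (size S < size s)%N -> phi S = 0) ->
  alt s phi = phi s *~ (-1) ^+ size s.
Proof.
elim: s phi => [|i s IHs] phi phi0 /=; first by rewrite mulr1z.
rewrite (eq_alt (psi := fun=> 0)) ?alt0 ?sub0r.
  rewrite IHs; first by rewrite exprS mulN1r mulrNz.
  by move=> S sS ltS; apply: phi0 => //=; rewrite eqxx.
move=> S sS; apply: phi0; first exact: subseq_trans sS (subseq_cons _ _).
by rewrite ltnS size_subseq.
Qed.

(** How a relation is used: once the proper sublists are known to contribute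
    nothing, neither does the whole list. *)
Lemma alt_eq0_full s phi :
  (forall S, subseq S s -> (size S < size s)%N -> phi S = 0) ->
  alt s phi = 0 -> phi s = 0.
Proof.
move=> /alt_full -> /eqP; rewrite -signr_odd.
by case: odd; rewrite ?expr0 ?expr1 ?mulrN1z ?mulr1z ?oppr_eq0 => /eqP.
Qed.

End Alternating.

Lemma alt_mulrz (I : eqType) (V : zmodType) (x : V) (s : seq I) (phi : seq I -> int) :
  alt s (fun S => x *~ phi S) = x *~ alt s phi.
Proof. by elim: s phi => //= i s IHs phi; rewrite !IHs mulrzBr. Qed.

(** * The Euler characteristic of a nerve *)

Section Nerve.
Variables (R : realType) (m : nat).
Implicit Types (F : set 'rV[R]_m) (s S : seq 'I_m).

Definition segment_closed F := forall (x y : 'rV[R]_m) (t : R),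
  0 <= t -> t <= 1 -> F x -> F y -> F (t *: x + (1 - t) *: y).

Definition nonempty_ind F : int := (`[< F !=set0 >] : nat)%:Z.

Definition upper_part F S := F `&` [set x | forall i, i \in S -> 1 <= x 0 i].

Lemma nonempty_ind1 F : F !=set0 -> nonempty_ind F = 1.
Proof. by rewrite /nonempty_ind; case: asboolP. Qed.

Lemma nonempty_ind0 F : ~ (F !=set0) -> nonempty_ind F = 0.
Proof. by rewrite /nonempty_ind; case: asboolP. Qed.

Lemma segment_closedI F G :
  segment_closed F -> segment_closed G -> segment_closed (F `&` G).
Proof. by move=> cF cG x y t t0 t1 [Fx Gx] [Fy Gy]; split; [apply: cF|apply: cG]. Qed.

Lemma segment_closed_ge i : segment_closed [set x | 1 <= x 0 i].
Proof. by move=> x y t t0 t1 /= hx hy; rewrite !mxE; nra. Qed.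

Lemma segment_closed_le i : segment_closed [set x | x 0 i <= 1].
Proof. by move=> x y t t0 t1 /= hx hy; rewrite !mxE; nra. Qed.

Lemma segment_closed_eq i : segment_closed [set x | x 0 i = 1].
Proof. by move=> x y t t0 t1 /= hx hy; rewrite !mxE hx hy; ring. Qed.

(** Nonemptiness of convex sets is additive when cutting along a hyperplane: a
    segment joining the two closed sides crosses the hyperplane. *)
Lemma nonempty_ind_cut F i : segment_closed F ->
  nonempty_ind F - nonempty_ind (F `&` [set x | 1 <= x 0 i]) =
  nonempty_ind (F `&` [set x | x 0 i <= 1]) -
  nonempty_ind (F `&` [set x | x 0 i = 1]).
Proof.
move=> cF.
have [hge|hge] := pselect (F `&` [set x | 1 <= x 0 i] !=set0); last first.
  rewrite (@nonempty_ind0 (F `&` [set x | 1 <= x 0 i])) //.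
  rewrite (@nonempty_ind0 (F `&` [set x | x 0 i = 1])); last first.
    by move=> [x [Fx /= x1]]; apply: hge; exists x; split => //=; rewrite x1.
  congr (nonempty_ind _ - _); apply/seteqP; split=> [x Fx|x []//]; split=> //=.
  by rewrite leNgt; apply/negP => x1; apply: hge; exists x; split=> //; exact: ltW.
have [hle|hle] := pselect (F `&` [set x | x 0 i <= 1] !=set0); last first.
  rewrite (@nonempty_ind0 (F `&` [set x | x 0 i <= 1])) //.
  rewrite (@nonempty_ind0 (F `&` [set x | x 0 i = 1])); last first.
    by move=> [x [Fx /= x1]]; apply: hle; exists x; split => //=; rewrite x1.
  apply/eqP; rewrite subr0 subr_eq0; apply/eqP.
  congr nonempty_ind; apply/seteqP; split=> [x Fx|x []//]; split=> //=.
  by rewrite leNgt; apply/negP => x1; apply: hle; exists x; split=> //; exact: ltW.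
have F0 : F !=set0 by case: hge => x [Fx _]; exists x.
rewrite !nonempty_ind1 //.
case: hge => x [Fx /= x1]; case: hle => y [Fy /= y1].
have [xy|xy] := eqVneq (x 0 i) (y 0 i).
  by exists x; split => //=; apply/eqP; rewrite eq_le x1 xy y1.
have d0 : 0 < x 0 i - y 0 i.
  by rewrite subr_gt0 lt_neqAle eq_sym xy (le_trans y1 x1).
pose t := (1 - y 0 i) / (x 0 i - y 0 i).
exists (t *: x + (1 - t) *: y); split.
  apply: cF => //; first by apply: divr_ge0; [rewrite subr_ge0|exact: ltW].
  by rewrite ler_pdivrMr // mul1r; lra.
by rewrite /= !mxE /t; field; lra.
Qed.

Lemma upper_part_cons F i S :
  upper_part F (i :: S) = upper_part (F `&` [set x | 1 <= x 0 i]) S.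
Proof.
apply/seteqP; split=> x [].
  move=> Fx /= h; split; first by split=> //=; apply: h; rewrite mem_head.
  by move=> j jS; apply: h; rewrite inE jS orbT.
move=> [Fx /= xi] h; split=> //= j; rewrite inE => /orP[/eqP->//|]; exact: h.
Qed.

Lemma upper_partI F G S : upper_part (F `&` G) S = upper_part F S `&` G.
Proof. exact: setIAC. Qed.

Lemma segment_closed_upper F S : segment_closed F -> segment_closed (upper_part F S).
Proof.
move=> cF; apply: segment_closedI => // x y t t0 t1 /= hx hy i iS.
by apply: (segment_closed_ge (i := i)) => //=; [exact: hx|exact: hy].
Qed.

(** The half-spaces x_i >= 1 (i in s) cover F, and the sum is the Euler
    characteristic of F minus that of the nerve of this cover.  The induction
    removes the first index i: cutting along x_i = 1 replaces F by its parts
    with x_i <= 1 and with x_i = 1, on both of which the other coordinates still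
    have a sum at least their number. *)
Lemma nerve s F : s != [::] -> segment_closed F ->
  (forall x, F x -> (size s)%:R <= \sum_(i <- s) x 0 i) ->
  alt s (fun S => nonempty_ind (upper_part F S)) = 0.
Proof.
elim: s F => // i s IHs F _ cF hF /=.
have -> : alt s (fun S => nonempty_ind (upper_part F (i :: S))) =
          alt s (fun S => nonempty_ind (upper_part (F `&` [set x | 1 <= x 0 i]) S)).
  by apply: eq_alt => S _; rewrite upper_part_cons.
case: s => [|j s] in IHs hF *.
  apply/eqP; rewrite /= subr_eq0; apply/eqP; congr (nonempty_ind (upper_part _ _)).
  apply/seteqP; split=> x; last by case.
  by move=> Fx; split=> //=; have := hF _ Fx; rewrite big_seq1.
rewrite -altB.
rewrite (@eq_alt _ _ _ _ (fun S =>
    nonempty_ind (upper_part F S `&` [set x | x 0 i <= 1]) -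
    nonempty_ind (upper_part F S `&` [set x | x 0 i = 1]))); last first.
  move=> S _; rewrite upper_partI.
  by apply: nonempty_ind_cut; exact: segment_closed_upper.
rewrite altB.
under eq_alt do rewrite -upper_partI.
under [X in _ - X]eq_alt do rewrite -upper_partI.
rewrite !IHs ?subr0 //.
- by apply: segment_closedI => //; exact: segment_closed_eq.
- move=> x [Fx /= x1]; have := hF _ Fx; rewrite [leRHS]big_cons x1 /= => h.
  by rewrite -(lerD2l 1) nat1r.
- by apply: segment_closedI => //; exact: segment_closed_le.
- move=> x [Fx /= x1]; have := hF _ Fx; rewrite [leRHS]big_cons /= => h.
  rewrite -(lerD2l 1) nat1r; apply: (le_trans h); exact: lerD.
Qed.

End Nerve.

(** * Convex combinations and lattice polytopes *)

Section ConvexCombinations.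
Variables (R : realType) (n m : nat).
Implicit Types (v : 'I_m -> 'cV[R]_n) (c : 'rV[R]_m).

(** Unnormalised convex combinations: stating this with the total weight as a
    factor makes the induction on s go through when initial weights vanish. *)
Lemma convex_hull_sum (A : set 'cV[R]_n) v c (s : seq 'I_m) :
  A !=set0 -> (forall i, A (v i)) -> (forall i, 0 <= c 0 i) ->
  exists2 y, convex_hull A y &
    \sum_(i <- s) c 0 i *: v i = (\sum_(i <- s) c 0 i) *: y.
Proof.
move=> [a Aa] Av c0; elim: s => [|i s [y Hy sumE]].
  by exists a; [exact: sub_gen_smallest|rewrite !big_nil scale0r].
rewrite !big_cons sumE; set T := \sum_(j <- s) _.
have T0 : 0 <= T by exact: sumr_ge0.
have [cT|cT] := eqVneq (c 0 i + T) 0.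
  exists y => //; move/eqP: cT; rewrite paddr_eq0 // => /andP[/eqP-> /eqP->].
  by rewrite addr0 !scale0r addr0.
have cT0 : 0 < c 0 i + T by rewrite lt_neqAle eq_sym cT addr_ge0.
exists ((c 0 i / (c 0 i + T)) *: v i + (1 - c 0 i / (c 0 i + T)) *: y).
  apply: convex_hullP => //; last exact: sub_gen_smallest.
    by apply: divr_ge0 => //; exact: ltW.
  by rewrite ler_pdivrMr // mul1r lerDl.
rewrite scalerDr !scalerA; congr (_ *: _ + _ *: _); by field.
Qed.

Lemma convex_hull_rangeP v (x : 'cV[R]_n) :
  convex_hull (range v) x <-> exists c, [/\ forall i, 0 <= c 0 i,
    \sum_i c 0 i = 1 & x = \sum_i c 0 i *: v i].
Proof.
split.
  pose C := [set y | exists c, [/\ forall i, 0 <= c 0 i,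
    \sum_i c 0 i = 1 & y = \sum_i c 0 i *: v i]].
  suff : convex_hull (range v) `<=` C by apply.
  apply: smallest_sub => [|_ [i _ <-]].
    apply/convexP => y z t t0 t1 [c [c0 c1 ->]] [d [d0 d1 ->]].
    exists (t *: c + (1 - t) *: d); split.
    - by move=> i; rewrite !mxE; apply: addr_ge0; apply: mulr_ge0 => //; rewrite subr_ge0.
    - rewrite (eq_bigr (fun i => t * c 0 i + (1 - t) * d 0 i)) => [|i _]; last by rewrite !mxE.
      by rewrite big_split /= -!mulr_sumr c1 d1; ring.
    - rewrite !scaler_sumr -big_split; apply: eq_bigr => i _.
      by rewrite !mxE [RHS]scalerDl !scalerA.
  exists (delta_mx 0 i); split.
  - by move=> j; rewrite mxE ler0n.
  - rewrite (bigD1 i) //= mxE !eqxx big1 ?addr0 // => j ji.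
    by rewrite mxE (negbTE ji).
  - rewrite (bigD1 i) //= mxE !eqxx big1 ?addr0 ?scale1r // => j ji.
    by rewrite mxE (negbTE ji) scale0r.
move=> [c [c0 c1 ->]].
have /(@convex_hull_sum _ v c (index_enum _)) : range v !=set0.
  case: (pickP (fun i : 'I_m => true)) => [i _|noi]; first by exists (v i), i.
  by move: c1; rewrite big_pred0 // => /esym/eqP; rewrite oner_eq0.
case=> // y Hy ->.
by rewrite c1 scale1r.
Qed.

End ConvexCombinations.

Section PolytopeFamilies.
Variables (R : realType) (n : nat).
Implicit Types P K : lattice_polytope R n.

Lemma polytope_convex P (x y : 'cV[R]_n) (t : R) : 0 <= t -> t <= 1 ->
  polytope_set P x -> polytope_set P y -> polytope_set P (t *: x + (1 - t) *: y).
Proof.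
by have [S [_ _ ->]] := polytope_setP P; exact: convex_hullP.
Qed.

Lemma polytope_family P : exists m (v : 'I_m.+1 -> 'cV[int]_n),
  P = convex_hull (range (fun i => lattice_vec (v i))) :> set 'cV[R]_n.
Proof.
have [S [/finite_seqP[s ->] [x xs] ->]] := polytope_setP P.
case: s x xs => // a s x xs.
exists (size s), (fun i => nth 0 (a :: s) i); congr convex_hull.
apply/seteqP; split=> [_ [y /= ys <-]|_ [i _ <-]]; last first.
  by exists (nth 0 (a :: s) i) => //=; exact/mem_nth.
have lt_i : (index y (a :: s) < (size s).+1)%N by rewrite -[ltnRHS]/(size (a :: s)) index_mem.
by exists (Ordinal lt_i) => //=; rewrite [nth _ _ _]nth_index.
Qed.

Lemma polytope_neq0 P : polytope_set P !=set0.
Proof.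
have [S [_ [x Sx] ->]] := polytope_setP P.
by exists (lattice_vec x); apply: sub_gen_smallest; exists x.
Qed.

End PolytopeFamilies.

(** * The relation between indicator functions of dilates *)

Section IndicatorRelation.
Variables (R : realType) (n m : nat) (v : 'I_m.+1 -> 'cV[int]_n).
Variables (P K : lattice_polytope R n).
Hypothesis PE : P = convex_hull (range (fun i => lattice_vec (v i))) :> set 'cV[R]_n.

Definition mixed_dilate (c : nat) (S : seq 'I_m.+1) : lattice_polytope R n :=
  polytope_translate (polytope_add K (polytope_dilate (c - size S) P))
    (\sum_(i <- S) v i).

(** F is the convex set of coefficient vectors that represent x as a point of
    K + kP.  Subtracting from c the indicator vector of S shows that x lies in
    K + (k - |S|) P + sum_(i in S) v_i exactly when some c in F has c_i >= 1 for
    all i in S, so [nerve] applies. *)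
Lemma indicator_relation (k : nat) (x : 'cV[R]_n) : (m < k)%N ->
  alt (enum 'I_m.+1)
    (fun S => (`[< polytope_set (mixed_dilate k S) x >] : nat)%:Z) = 0.
Proof.
move=> lt_mk.
pose F := [set c : 'rV[R]_m.+1 | [/\ forall i, 0 <= c 0 i,
  \sum_i c 0 i = k%:R & polytope_set K (x - \sum_i c 0 i *: lattice_vec (v i))]].
rewrite -(@nerve _ _ (enum 'I_m.+1) F).
- apply: eq_alt => S sS.
  have uS : uniq S by exact: subseq_uniq sS (enum_uniq _).
  have leS : (size S <= k)%N.
    by apply: leq_trans lt_mk; rewrite -[leqRHS]size_enum_ord; exact: size_subseq.
  rewrite /nonempty_ind; congr ((_ : nat)%:Z); congr nat_of_bool.
  pose ind := \row_i ((i \in S)%:R : R).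
  have ind_sum (f : 'I_m.+1 -> 'cV[R]_n) : \sum_i ind 0 i *: f i = \sum_(i <- S) f i.
    rewrite (eq_bigr (fun i => if i \in S then f i else 0)).
      by rewrite -big_mkcond big_uniq.
    by move=> i _; rewrite mxE; case: ifP; rewrite ?scale1r ?scale0r.
  have ind_size : \sum_i ind 0 i = (size S)%:R.
    rewrite (eq_bigr (fun i => if i \in S then 1 else 0)).
      by rewrite -big_mkcond -big_uniq //= big_const_seq count_predT iter_addr_0.
    by move=> i _; rewrite mxE; case: ifP.
  have lvS : lattice_vec (\sum_(i <- S) v i) = \sum_(i <- S) lattice_vec (v i) :> 'cV[R]_n.
    by rewrite /lattice_vec raddf_sum.
  apply/asboolP/asboolP.
    move=> [_ [q Kq [_ [p Pp <-] <-]] xE].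
    move: Pp; rewrite PE => /convex_hull_rangeP[c [c0 c1 pE]].
    exists ((k - size S)%:R *: c + ind); split.
      split.
      + by move=> i; rewrite !mxE addr_ge0 // mulr_ge0.
      + rewrite (eq_bigr (fun i => (k - size S)%:R * c 0 i + ind 0 i)).
          by rewrite big_split /= -mulr_sumr c1 mulr1 ind_size -natrD subnK.
        by move=> i _; rewrite !mxE.
      + rewrite (eq_bigr (fun i => (k - size S)%:R *: (c 0 i *: lattice_vec (v i)) +
              ind 0 i *: lattice_vec (v i))).
          rewrite big_split /= -scaler_sumr -pE ind_sum -xE lvS.
          by rewrite -(addrA q) addrK.
        by move=> i _; rewrite !mxE scalerDl scalerA.
    by move=> i iS; rewrite !mxE iS lerDr mulr_ge0.
  move=> [d [[d0 d1 Kd] dS]].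
  pose T : R := (k - size S)%:R.
  have dT : \sum_i (d - ind) 0 i = T.
    rewrite (eq_bigr (fun i => d 0 i - ind 0 i)) => [|i _]; last by rewrite !mxE.
    by rewrite sumrB d1 ind_size /T natrB.
  have dge i : 0 <= (d - ind) 0 i.
    rewrite !mxE; case: (boolP (i \in S)) => iS; last by rewrite subr0.
    by rewrite subr_ge0; exact: dS.
  have [p Pp pE] : exists2 p, polytope_set P p & \sum_i (d - ind) 0 i *: lattice_vec (v i) = T *: p.
    have := @convex_hull_sum _ _ _ (range (fun i => lattice_vec (v i)))
      (fun i => lattice_vec (v i)) (d - ind) (index_enum _).
    case=> //.
    - by exists (lattice_vec (v ord0)), ord0.
    - by rewrite -PE dT => p Pp pE; exists p.
  exists ((x - \sum_i d 0 i *: lattice_vec (v i)) + T *: p).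
    by exists (x - \sum_i d 0 i *: lattice_vec (v i)) => //; exists (T *: p) => //; exists p.
  have -> : T *: p = \sum_i d 0 i *: lattice_vec (v i) - lattice_vec (\sum_(i <- S) v i).
    rewrite -pE lvS -ind_sum -sumrB; apply: eq_bigr => i _.
    by rewrite !mxE scalerBl.
  by rewrite addrA !subrK.
- by rewrite -size_eq0 size_enum_ord.
- move=> c d t t0 t1 [c0 c1 Kc] [d0 d1 Kd]; split.
  + by move=> i; rewrite !mxE; apply: addr_ge0; apply: mulr_ge0 => //; rewrite subr_ge0.
  + rewrite (eq_bigr (fun i => t * c 0 i + (1 - t) * d 0 i)) => [|i _]; last by rewrite !mxE.
    by rewrite big_split /= -!mulr_sumr c1 d1; ring.
  + rewrite (eq_bigr (fun i => t *: (c 0 i *: lattice_vec (v i)) +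
      (1 - t) *: (d 0 i *: lattice_vec (v i)))) => [|i _]; last by rewrite !mxE [LHS]scalerDl !scalerA.
    rewrite big_split /= -!scaler_sumr.
    have -> : x = t *: x + (1 - t) *: x by rewrite -scalerDl [t + _]addrC subrK scale1r.
    by rewrite opprD addrACA -!scalerBr; apply: polytope_convex.
- by move=> c [c0 c1 _]; rewrite size_enum_ord big_enum /= c1 ler_nat.
Qed.

End IndicatorRelation.

(** * Finite differences and polynomials *)

Section Differences.

Definition fwd_diff (V : zmodType) (g : nat -> V) (k : nat) : V := g k.+1 - g k.

Lemma alt_fwd_diff (I : eqType) (V : zmodType) (s : seq I) (g : nat -> V) (c : nat) :
  alt s (fun S => g (c + size s - size S)%N) = iter (size s) (@fwd_diff V) g c.
Proof.
elim: s c => [|i s IHs] c /=; first by rewrite addn0 subn0.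
rewrite addnS -addSn IHs; congr (_ - _); rewrite -IHs.
by apply: eq_alt => S _; rewrite addSn subSS.
Qed.

(** This accounts for the translation of the lattice points by
    sum_(i in S) v_i: the extra term is a difference of g of order |s| - 1,
    multiplied by sum v_i, so that one more difference kills it. *)
Lemma alt_weighted_fwd_diff (I : eqType) (V : zmodType) (v : I -> V) (s : seq I)
    (g : nat -> int) (c : nat) :
  (forall k, iter (size s) (@fwd_diff _) g k = 0) ->
  alt s (fun S => (\sum_(i <- S) v i) *~ fwd_diff g (c + size s - size S)%N) = 0.
Proof.
elim: s g => [|i s IHs] g /=; first by rewrite big_nil mul0rz.
rewrite -/(iter (size s).+1 _ _) => g0; rewrite -altB.
rewrite (@eq_alt _ _ _ _ (fun S =>
    (\sum_(j <- S) v j) *~ fwd_diff (fwd_diff g) (c + size s - size S)%N -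
    v i *~ fwd_diff g (c + size s - size S)%N)).
  rewrite altB IHs => [|k]; last by rewrite -iterSr g0.
  by rewrite alt_mulrz alt_fwd_diff -iterSr g0 mulr0z subr0.
move=> S /size_subseq leS; rewrite addnS subSS big_cons mulrzDl.
rewrite subSn; last by rewrite (leq_trans leS) ?leq_addl.
by rewrite opprD addrCA addrC -mulrzBr.
Qed.

Lemma newton (V : zmodType) (g : nat -> V) (M k : nat) :
  (forall j, iter M (@fwd_diff _) g j = 0) ->
  g k = \sum_(i < M) iter i (@fwd_diff _) g 0%N *+ 'C(k, i).
Proof.
elim: k M g => [|k IHk] M g gM.
  case: M gM => [|M] gM; first by rewrite big_ord0; exact: (gM 0%N).
  by rewrite big_ord_recl /= bin0 mulr1n big1 ?addr0 // => i _; rewrite bin0n.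
case: M gM => [|M] gM; first by rewrite big_ord0; exact: gM.
have -> : g k.+1 = g k + fwd_diff g k by rewrite /fwd_diff addrC subrK.
rewrite (IHk M.+1 g gM) (IHk M (fwd_diff g)) => [|j]; last by rewrite -iterSr gM.
rewrite !big_ord_recl /= !bin0 -addrA; congr (_ + _).
rewrite -big_split /=; apply: eq_bigr => i _.
by rewrite /bump /= add1n -iterSr /= binS mulrnDr.
Qed.

Definition bin_poly (i : nat) : {poly rat} :=
  (i`!%:R)^-1 *: \prod_(j < i) ('X - (j%:R)%:P).

Lemma bin_polyE (i k : nat) : (bin_poly i).[k%:R] = 'C(k, i)%:R.
Proof.
rewrite hornerZ horner_prod.
have -> : \prod_(j < i) ('X - (j%:R)%:P : {poly rat}).[k%:R] = (k ^_ i)%:R.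
  have [lt_ki|le_ik] := ltnP k i.
    rewrite ffact_small // (bigD1 (Ordinal lt_ki)) //= !hornerE subrr mul0r //.
  rewrite ffact_prod natr_prod; apply: eq_bigr => j _.
  by rewrite !hornerE natrB // (leq_trans _ le_ik) // ltnW.
by rewrite -bin_ffact natrM mulrC mulfK // pnatr_eq0 -lt0n fact_gt0.
Qed.

Lemma fwd_diff_poly (g : nat -> rat) (M : nat) :
  (forall j, iter M (@fwd_diff _) g j = 0) ->
  exists p : {poly rat}, forall k, g k = p.[k%:R].
Proof.
move=> gM; exists (\sum_(i < M) iter i (@fwd_diff _) g 0%N *: bin_poly i) => k.
rewrite {1}(newton k gM) horner_sum; apply: eq_bigr => i _.
by rewrite hornerZ bin_polyE mulr_natr.
Qed.

Lemma poly_nat_inj (p q : {poly rat}) :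
  (forall k : nat, p.[k%:R] = q.[k%:R]) -> p = q.
Proof.
move=> pq; apply/eqP; rewrite -subr_eq0; apply/eqP.
apply: (@roots_geq_poly_eq0 _ _ [seq k%:R | k <- iota 0 (size (p - q))]).
- by apply/allP => _ /mapP[k _ ->]; rewrite /root !hornerE pq subrr.
- by rewrite map_inj_uniq ?iota_uniq // => a b /eqP; rewrite eqr_nat => /eqP.
- by rewrite size_map size_iota.
Qed.

Lemma poly_eventually_pos (p : {poly rat}) : 0 < lead_coef p ->
  exists N e : rat, 0 < e /\ forall x, N <= x -> e <= p.[x].
Proof.
elim/poly_ind: p => [|p c IHp]; first by rewrite lead_coef0 ltxx.
have [->|p0] := eqVneq p 0.
  by rewrite mul0r add0r lead_coefC => c0; exists 0, c; split=> // x _; rewrite hornerC.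
rewrite lead_coefDl ?size_mulX ?size_polyC //; last first.
  by case: (c == 0) => //=; rewrite ltnS lt0n size_poly_eq0.
rewrite lead_coefMX => /IHp[N [e [e0 He]]].
exists (Num.max 0 (Num.max N ((1 - c) / e))), 1; split=> // x.
rewrite !ge_max => /and3P[x0 /He Nx]; rewrite ler_pdivrMr // => cx.
by rewrite !hornerE; nra.
Qed.

(** Otherwise p - q, or - p - q, has a positive leading coefficient and
    is eventually positive. *)
Lemma size_poly_growth (p q : {poly rat}) :
  (forall k : nat, `|p.[k%:R]| <= q.[k%:R]) -> (size p <= size q)%N.
Proof.
move=> hpq; rewrite leqNgt; apply/negP => lt_qp.
wlog lp : p hpq lt_qp / 0 < lead_coef p.
  move=> hwlog; have p0 : lead_coef p != 0.
    by rewrite lead_coef_eq0 -size_poly_gt0 (leq_ltn_trans _ lt_qp).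
  have [lp|lp|/eqP] := ltrgtP 0 (lead_coef p); first exact: (hwlog p).
    apply: (hwlog (- p)); rewrite ?size_polyN ?lead_coefN ?oppr_gt0 //.
    by move=> k; rewrite hornerN normrN.
  by rewrite eq_sym (negbTE p0).
have /poly_eventually_pos[N [e [e0 He]]] : 0 < lead_coef (p - q).
  by rewrite lead_coefDl ?size_polyN.
have [k Nk] : exists k : nat, N <= k%:R.
  by exists (Num.bound `|N|); rewrite (le_trans (ler_norm N)) // ltW // archi_boundP.
have := He _ Nk; rewrite !hornerE => h.
have := hpq k; have := ler_norm p.[k%:R]; lra.
Qed.

End Differences.

(** * Sums over the lattice points of a polytope *)

Section LatticeSums.
Variables (R : realType) (n : nat).
Implicit Types P K : lattice_polytope R n.

Definition lattice_total (V : zmodType) (f : 'cV[int]_n -> V) P : V :=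
  \sum_(x \in lattice_points P) f x.

Definition point_count P : int := lattice_total (fun=> 1) P.

(** Summation over a fixed finite set with indicator weights makes the sum linear
    in the indicator function of P. *)
Lemma lattice_totalE (V : zmodType) (f : 'cV[int]_n -> V) P (X : seq 'cV[int]_n) :
  uniq X -> lattice_points P `<=` [set` X] ->
  lattice_total f P =
    \sum_(x <- X) f x *~ (`[< polytope_set P (lattice_vec x) >] : nat)%:Z.
Proof.
move=> uX PX; rewrite /lattice_total.
have {1}-> : lattice_points P = [set` [pred x | x \in lattice_points P]].
  by apply/seteqP; split=> x /=; rewrite inE.
rewrite -(@bigfs _ _ _ _ X) //; last by move=> x /=; rewrite inE => /PX /= ->.
rewrite big_mkcond; apply: eq_bigr => x _ /=.
have -> : (x \in lattice_points P) = `[< polytope_set P (lattice_vec x) >].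
  by apply/idP/asboolP; rewrite inE.
by case: asboolP; rewrite ?mulr1z ?mulr0z.
Qed.

Lemma lattice_points_cover P : exists2 X, uniq X & lattice_points P `<=` [set` X].
Proof.
have /finite_seqP[X XE] := finite_lattice_points P.
exists (undup X); first exact: undup_uniq.
by rewrite XE => x /=; rewrite mem_undup.
Qed.

Lemma subseq_lattice_points_cover (I : eqType) (s : seq I) (Phi : seq I -> lattice_polytope R n) :
  exists2 X, uniq X & forall S, subseq S s -> lattice_points (Phi S) `<=` [set` X].
Proof.
elim: s Phi => [|i s IHs] Phi.
  have [X uX PX] := lattice_points_cover (Phi [::]).
  by exists X => // S; rewrite subseq0 => /eqP->.
have [X uX PX] := IHs Phi; have [Y uY PY] := IHs (fun S => Phi (i :: S)).
exists (undup (X ++ Y)) => [|S sS x Sx /=]; first exact: undup_uniq.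
rewrite mem_undup mem_cat; apply/orP.
case: S sS Sx => [|j S] /= sS Sx; first by left; apply: PX Sx; exact: sub0seq.
by move: sS Sx; case: eqP => [->|_] sS Sx; [right; exact: (PY S)|left; exact: PX Sx].
Qed.

Lemma alt_lattice_total (I : eqType) (s : seq I) (Phi : seq I -> lattice_polytope R n)
    (V : zmodType) (f : 'cV[int]_n -> V) :
  (forall x : 'cV[R]_n, alt s (fun S => (`[< polytope_set (Phi S) x >] : nat)%:Z) = 0) ->
  alt s (fun S => lattice_total f (Phi S)) = 0.
Proof.
move=> Phi0; have [X uX PX] := subseq_lattice_points_cover s Phi.
rewrite (eq_alt (fun S sS => lattice_totalE f uX (PX S sS))) alt_sum.
by rewrite big1 // => x _; rewrite alt_mulrz Phi0 mulr0z.
Qed.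

Lemma lattice_points_translate P (v : 'cV[int]_n) :
  lattice_points (polytope_translate P v) = (fun x => x + v) @` lattice_points P.
Proof.
apply/seteqP; split=> [x [y Py yE]|_ [y Py <-]]; last first.
  by exists (lattice_vec y) => //; rewrite /lattice_vec map_mxD.
exists (x - v); last by rewrite subrK.
rewrite /lattice_points /= /lattice_vec map_mxB.
by rewrite -/(lattice_vec x) -yE /lattice_vec addrK.
Qed.

Lemma lattice_total_translate (V : zmodType) (f : 'cV[int]_n -> V) P (v : 'cV[int]_n) :
  lattice_total f (polytope_translate P v) = lattice_total (fun x => f (x + v)) P.
Proof.
rewrite /lattice_total lattice_points_translate fsbig_image //.
by move=> x y _ _; apply: addIr.
Qed.

Lemma point_count_translate P (v : 'cV[int]_n) :
  point_count (polytope_translate P v) = point_count P.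
Proof. exact: lattice_total_translate. Qed.

Lemma lattice_sum_translate P (v : 'cV[int]_n) :
  lattice_sum (polytope_translate P v) = lattice_sum P + v *~ point_count P.
Proof.
rewrite [LHS](lattice_total_translate id).
have [X uX PX] := lattice_points_cover P.
rewrite [lattice_sum P](lattice_totalE id uX PX) /point_count !(lattice_totalE _ uX PX).
rewrite mulrz_sumr -big_split; apply: eq_bigr => x _ /=.
by rewrite mulrzDl intz.
Qed.

End LatticeSums.

(** * Polynomiality of lattice point sums *)

Section PolynomialBehaviour.
Variables (R : realType) (n m : nat) (v : 'I_m.+1 -> 'cV[int]_n).
Variables (P K : lattice_polytope R n).
Hypothesis PE : P = convex_hull (range (fun i => lattice_vec (v i))) :> set 'cV[R]_n.

Let shifted k := polytope_add K (polytope_dilate k P).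

Lemma point_count_fwd_diff k :
  iter m.+1 (@fwd_diff _) (fun j => point_count (shifted j)) k = 0.
Proof.
have sz : size (enum 'I_m.+1) = m.+1 by rewrite size_enum_ord.
rewrite -{1}sz -alt_fwd_diff sz.
rewrite -[RHS](@alt_lattice_total _ _ _ (enum 'I_m.+1) (mixed_dilate v P K (k + m.+1)) _ (fun=> 1)).
  by apply: eq_alt => S _; rewrite -[RHS]/(point_count _) point_count_translate.
by move=> x; apply: indicator_relation; rewrite ?leq_addl.
Qed.

(** Translating by v adds v times the number of points, so the (m+1)-st
    difference of the sums is minus an alternating sum of point counts weighted by
    lattice vectors; the next difference of the latter vanishes by
    [alt_weighted_fwd_diff]. *)
Lemma lattice_sum_fwd_diff k :
  iter m.+2 (@fwd_diff _) (fun j => lattice_sum (shifted j)) k = 0.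
Proof.
have sz : size (enum 'I_m.+1) = m.+1 by rewrite size_enum_ord.
pose weight j := alt (enum 'I_m.+1) (fun S =>
  (\sum_(i <- S) v i) *~ point_count (shifted (j + m.+1 - size S))).
have diffE j : iter m.+1 (@fwd_diff _) (fun j => lattice_sum (shifted j)) j = - weight j.
  apply/eqP; rewrite -addr_eq0 -{1}sz -alt_fwd_diff sz -altD; apply/eqP.
  rewrite -[RHS](@alt_lattice_total _ _ _ (enum 'I_m.+1) (mixed_dilate v P K (j + m.+1)) _ id).
    by apply: eq_alt => S _; rewrite -[RHS]/(lattice_sum _) lattice_sum_translate.
  by move=> x; apply: indicator_relation; rewrite ?leq_addl.
rewrite iterS /fwd_diff !diffE opprK addrC; apply/eqP.
rewrite subr_eq0 eq_sym -subr_eq0 -altB; apply/eqP.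
rewrite -[RHS](@alt_weighted_fwd_diff _ _ v (enum 'I_m.+1) (fun j => point_count (shifted j)) k).
  apply/eq_alt => S /size_subseq; rewrite sz => leS.
  by rewrite -mulrzBr addSn subSn; last by rewrite (leq_trans leS) ?leq_addl.
by move=> j; rewrite sz point_count_fwd_diff.
Qed.

End PolynomialBehaviour.

(** * Existence and equivariance of the discrete Steiner point *)

Section PolytopeOperations.
Variables (R : realType) (n : nat).
Implicit Types P Q K : lattice_polytope R n.

Lemma polytope_addC P Q : polytope_add P Q = polytope_add Q P.
Proof.
apply: lattice_polytope_inj; apply/seteqP.
by split=> _ [x Px [y Qy <-]]; exists y => //; exists x => //; rewrite addrC.
Qed.

Lemma polytope_dilate0 P : polytope_set (polytope_dilate 0 P) = [set 0].
Proof.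
apply/seteqP; split=> [_ [x _ <-]|x /= ->]; first by rewrite /= scale0r.
by have [y Py] := polytope_neq0 P; exists y => //; rewrite scale0r.
Qed.

Lemma polytope_add_dilate0 P K : polytope_add (polytope_dilate 0 K) P = P.
Proof.
apply: lattice_polytope_inj.
have K0 := polytope_dilate0 K; apply/seteqP; split=> [_ [y Ky [x Px <-]]|x Px].
  by move: Ky; rewrite K0 => /= ->; rewrite add0r.
by exists 0; [rewrite K0|exists x; rewrite ?add0r].
Qed.

Lemma polytope_dilate_add k P Q : polytope_dilate k (polytope_add P Q) =
  polytope_add (polytope_dilate k P) (polytope_dilate k Q).
Proof.
apply: lattice_polytope_inj; apply/seteqP; split.
  move=> _ [_ [x Px [y Qy <-]] <-]; exists (k%:R *: x); first by exists x.
  by exists (k%:R *: y); [exists y|rewrite scalerDr].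
move=> _ [_ [x Px <-] [_ [y Qy <-] <-]]; exists (x + y); last by rewrite scalerDr.
by exists x => //; exists y.
Qed.

Lemma polytope_dilate_translate k P (v : 'cV[int]_n) :
  polytope_dilate k (polytope_translate P v) =
  polytope_translate (polytope_dilate k P) (v *+ k).
Proof.
have vk : lattice_vec (v *+ k) = k%:R *: lattice_vec v :> 'cV[R]_n.
  by rewrite /lattice_vec raddfMn scaler_nat.
apply: lattice_polytope_inj; apply/seteqP; split.
  move=> _ [_ [x Px <-] <-]; exists (k%:R *: x); first by exists x.
  by rewrite vk scalerDr.
move=> _ [_ [x Px <-] <-]; exists (x + lattice_vec v); first by exists x.
by rewrite vk scalerDr.
Qed.

Lemma polytope_dilate_mulmx k P (phi : 'M[int]_n) :
  polytope_dilate k (polytope_mulmx phi P) = polytope_mulmx phi (polytope_dilate k P).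
Proof.
apply: lattice_polytope_inj; apply/seteqP; split.
  move=> _ [_ [x Px <-] <-]; exists (k%:R *: x); first by exists x.
  by rewrite scalemxAr.
move=> _ [_ [x Px <-] <-]; exists (map_mx intr phi *m x); first by exists x.
by rewrite scalemxAr.
Qed.

Lemma lattice_vec_inj : injective (@lattice_vec R n).
Proof.
move=> x y /matrixP xy; apply/matrixP => i j.
by have := xy i j; rewrite !mxE => /intr_inj.
Qed.

Lemma lattice_points_dilate0 P : lattice_points (polytope_dilate 0 P) = [set 0].
Proof.
rewrite /lattice_points polytope_dilate0; apply/seteqP; split=> x /=.
  by move=> x0; apply: lattice_vec_inj; rewrite x0 /lattice_vec raddf0.
by move=> ->; rewrite /lattice_vec raddf0.
Qed.

Lemma lattice_total_dilate0 (V : zmodType) (f : 'cV[int]_n -> V) P :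
  lattice_total f (polytope_dilate 0 P) = f 0.
Proof. by rewrite /lattice_total lattice_points_dilate0 fsbig_set1. Qed.

Lemma lattice_sum_mulmx P (phi : 'M[int]_n) : \det phi = 1 ->
  lattice_sum (polytope_mulmx phi P) = phi *m lattice_sum P.
Proof.
move=> dphi; have uphi : phi \in unitmx by rewrite unitmxE dphi unitr1.
rewrite /lattice_sum.
have -> : lattice_points (polytope_mulmx phi P) = mulmx phi @` lattice_points P.
  apply/seteqP; split=> [x [y Py yE]|_ [y Py <-]]; last first.
    by exists (lattice_vec y) => //; rewrite /lattice_vec map_mxM.
  exists (invmx phi *m x); last by rewrite mulKVmx.
  rewrite /lattice_points /= /lattice_vec map_mxM.
  rewrite -/(lattice_vec x) -yE mulmxA -map_mxM mulVmx // map_mx1 mul1mx //.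
rewrite fsbig_image; last by move=> x y _ _ /(can_inj (mulKmx uphi)).
have [X uX PX] := lattice_points_cover P.
rewrite -![\sum_(_ \in _) _]/(lattice_total _ P) !(lattice_totalE _ uX PX).
rewrite mulmx_sumr; apply: eq_bigr => x _.
by rewrite raddfMz.
Qed.

End PolytopeOperations.

Lemma iter_fwd_diff_raddf (U V : zmodType) (h : {additive U -> V}) (g : nat -> U) M k :
  iter M (@fwd_diff V) (fun j => h (g j)) k = h (iter M (@fwd_diff U) g k).
Proof. by elim: M k => //= M IHM k; rewrite /fwd_diff !IHM raddfB. Qed.

Lemma iter_fwd_diffB (V : zmodType) (g h : nat -> V) M k :
  iter M (@fwd_diff V) (fun j => g j - h j) k =
  iter M (@fwd_diff V) g k - iter M (@fwd_diff V) h k.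
Proof.
elim: M k => //= M IHM k.
by rewrite /fwd_diff !IHM !opprD addrACA.
Qed.

Section SteinerPolynomial.
Variables (R : realType) (n : nat).
Implicit Types P Q K : lattice_polytope R n.

Definition rat_coord (r : 'I_n) (x : 'cV[int]_n) : rat := (x r 0)%:~R.

Fact rat_coord_additive r : zmod_morphism (rat_coord r).
Proof. by move=> x y; rewrite /rat_coord !mxE rmorphB. Qed.

HB.instance Definition _ r :=
  GRing.isZmodMorphism.Build _ _ (rat_coord r) (@rat_coord_additive r).

(** The order M must not depend on K: in the proof of additivity K runs through
    all the dilates of the other summand. *)
Lemma lattice_sum_fwd_diff_eq0 P r : exists M, forall K k,
  iter M (@fwd_diff _) (fun j =>
    rat_coord r (lattice_sum (polytope_add K (polytope_dilate j P)))) k = 0.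
Proof.
have [m [v PE]] := polytope_family P; exists m.+2 => K k.
by rewrite iter_fwd_diff_raddf (lattice_sum_fwd_diff K PE) raddf0.
Qed.

Lemma point_count_poly P : exists p : {poly rat}, forall k,
  (point_count (polytope_dilate k P))%:~R = p.[k%:R].
Proof.
have [m [v PE]] := polytope_family P.
apply: (@fwd_diff_poly _ m.+1) => k.
rewrite iter_fwd_diff_raddf -[RHS](raddf0 (intr : int -> rat)); congr intr.
rewrite -(point_count_fwd_diff (polytope_dilate 0 P) PE k).
by congr (iter _ _ _ _); apply/funext => j; rewrite polytope_add_dilate0.
Qed.

Lemma lattice_sum_poly P r : exists p : {poly rat}, forall k,
  rat_coord r (lattice_sum (polytope_dilate k P)) = p.[k%:R].
Proof.
have [M PM] := lattice_sum_fwd_diff_eq0 P r.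
apply: (@fwd_diff_poly _ M) => k; rewrite -(PM (polytope_dilate 0 P) k).
by congr (iter _ _ _ _); apply/funext => j; rewrite polytope_add_dilate0.
Qed.

Lemma polytope_bounded P : exists M : nat, forall x i, polytope_set P x -> `|x i 0| <= M%:R.
Proof.
have [m [v PE]] := polytope_family P.
exists (\sum_j \sum_i absz (v j i 0%R))%N => x i; rewrite PE => /convex_hull_rangeP[c [c0 c1 ->]].
rewrite summxE; apply: le_trans (ler_norm_sum _ _ _) _.
rewrite -[leRHS]mul1r -[X in X * _]c1 mulr_suml; apply: ler_sum => j _.
rewrite !mxE normrM (ger0_norm (c0 j)) ler_wpM2l //.
rewrite -intr_norm -abszE -pmulrn ler_nat.
by rewrite (bigD1 j) //= (bigD1 i) //= -addnA leq_addr.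
Qed.

(** Every lattice point of kP lies in the cube of the vectors with entries at
    most kM in absolute value, which has (2kM + 1)^n lattice points. *)
Lemma lattice_sum_growth P r : exists M : nat, forall k,
  `|rat_coord r (lattice_sum (polytope_dilate k P))| <=
     ((k * M + k * M).+1 ^ n * (k * M))%:R.
Proof.
have [M PM] := polytope_bounded P; exists M => k.
set N := (k * M)%N.
pose box := [seq map_mx (fun j : 'I_(N + N).+1 => (j : nat)%:Z - N%:Z) x |
              x <- enum {: 'cV['I_(N + N).+1]_n}].
have szbox : size box = ((N + N).+1 ^ n)%N.
  by rewrite size_map -cardT card_mx muln1 card_ord.
have ubox : uniq box.
  rewrite map_inj_uniq ?enum_uniq // => x y /matrixP xy; apply/matrixP => i j.
  have := xy i j; rewrite !mxE => /addIr; case => h; exact: val_inj.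
have hx x i : polytope_set (polytope_dilate k P) (lattice_vec x) -> `|x i 0| <= N%:Z.
  move=> [y Py yx]; have : `|(lattice_vec x : 'cV[R]_n) i 0| <= N%:R.
    by rewrite -yx mxE normrM normr_nat /N natrM ler_wpM2l // PM.
  by rewrite mxE -intr_norm -[leRHS]/(N%:~R) ler_int.
have hbox : lattice_points (polytope_dilate k P) `<=` [set` box].
  move=> x Px; apply/mapP; exists (map_mx (fun z : int => inord (absz (z + N%:Z))) x).
    by rewrite mem_enum.
  apply/matrixP => i j; rewrite !mxE ord1.
  move: (hx x i Px); rewrite ler_norml => /andP[h1 h2].
  have h0 : 0 <= x i 0 + N%:Z by rewrite -lerBlDr sub0r.
  rewrite inordK; first by rewrite gez0_abs // addrK.
  by rewrite ltnS -lez_nat gez0_abs // PoszD lerD2r.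
rewrite -[lattice_sum _]/(lattice_total id _) (lattice_totalE _ ubox hbox).
rewrite raddf_sum; apply: le_trans (ler_norm_sum _ _ _) _.
rewrite natrM -szbox mulr_natl -iter_addr_0 -count_predT -big_const_seq.
apply: ler_sum => x _; rewrite raddfMz; case: asboolP => [/hx hxr|_]; last first.
  by rewrite mulr0z normr0.
by rewrite mulr1z /rat_coord -intr_norm -[leRHS]/(N%:~R) ler_int.
Qed.

Lemma ehrhart_expansion_exists P : exists c, ehrhart_expansion P c.
Proof.
have [p pE] := choice (lattice_sum_poly P).
have szp r : (size (p r) <= n.+2)%N.
  have [M PM] := lattice_sum_growth P r.
  pose q : {poly rat} := ((M + M)%:R *: 'X + 1) ^+ n * (M%:R *: 'X).
  have /size_poly_growth/leq_trans-> // : forall k : nat, `|(p r).[k%:R]| <= q.[k%:R].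
    move=> k; rewrite -pE; apply: le_trans (PM k) _.
    have qE : q.[k%:R] = ((M + M)%:R * k%:R + 1) ^+ n * (M%:R * k%:R).
      by rewrite !hornerE //= mulrA.
    have -> : q.[k%:R] = ((k * M + k * M).+1 ^ n * (k * M))%:R.
      rewrite qE natrM natrX -natr1 natrM; congr (_ ^+ n * _); last by rewrite mulrC.
      by rewrite !natrD !natrM; ring.
    by [].
  apply: leq_trans (size_polyMleq _ _) _.
  have le0 : (size ((M + M)%:R *: 'X + 1 : {poly rat})%R <= 2)%N.
    apply: leq_trans (size_polyD _ _) _; rewrite geq_max size_poly1 andbT.
    by apply: leq_trans (size_scale_leq _ _) _; rewrite size_polyX.
  have le1 : (size (((M + M)%:R *: 'X + 1) ^+ n : {poly rat}) <= n.+1)%N.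
    apply: leq_trans (size_poly_exp_leq _ _) _; rewrite ltnS -[leqRHS]mul1n leq_mul //.
    by move: le0; case: (size _) => [|[|[|?]]].
  have le2 : (size (M%:R *: 'X : {poly rat}) <= 2)%N.
    by apply: leq_trans (size_scale_leq _ _) _; rewrite size_polyX.
  have := leq_add le1 le2; rewrite addnS addn1.
  by case: (_ + _)%N.
pose c i : 'cV[rat]_n := \col_r (p r)`_i.
exists c => k; apply/matrixP => r s; rewrite ord1 => {s}.
rewrite mxE [LHS]pE summxE (horner_coef_wide _ (szp r)) big_ord_recl /=.
have := pE r 0%N; rewrite -horner_coef0 => <-.
rewrite -[lattice_sum _]/(lattice_total id _) lattice_total_dilate0 raddf0 mul0r add0r.
rewrite big_add1 big_mkord; apply: eq_bigr => i _.
by rewrite /bump /= add1n !mxE mulrC.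
Qed.

(** The linear coefficient can be read off any polynomial, of whatever degree,
    that interpolates the lattice sums. *)
Lemma ehrhart_coef1E P r (p : {poly rat}) :
  (forall k, rat_coord r (lattice_sum (polytope_dilate k P)) = p.[k%:R]) ->
  ehrhart_coef P 1 r 0 = p`_1.
Proof.
move=> pE; have [c cE] := ehrhart_expansion_exists P.
rewrite (ehrhart_coefE cE) //.
pose q := \poly_(i < n.+2) (if i == 0%N then 0 else c i r 0).
suff -> : p = q by rewrite coef_poly.
apply: poly_nat_inj => k; rewrite -pE horner_poly big_ord_recl /= mul0r add0r.
have -> : rat_coord r (lattice_sum (polytope_dilate k P)) =
    (map_mx intr (lattice_sum (polytope_dilate k P)) : 'cV[rat]_n) r 0 by rewrite mxE.
rewrite cE summxE big_add1 big_mkord.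
by apply: eq_bigr => i _; rewrite /bump /= add1n !mxE mulrC.
Qed.

Lemma discrete_steiner_pointE P r (p : {poly rat}) :
  (forall k, rat_coord r (lattice_sum (polytope_dilate k P)) = p.[k%:R]) ->
  discrete_steiner_point P r 0 = ratr p`_1.
Proof. by move=> /ehrhart_coef1E pE; rewrite mxE pE. Qed.

Lemma discrete_steiner_SLZ : SLZ_equivariant (@discrete_steiner_point R n).
Proof.
move=> phi P dphi; apply/matrixP => r s; rewrite ord1 => {s}.
have [p pE] := choice (lattice_sum_poly P).
rewrite (@discrete_steiner_pointE _ _ (\sum_j (phi r j)%:~R *: p j)) => [|k].
  rewrite coef_sum mxE rmorph_sum; apply: eq_bigr => j _.
  by rewrite coefZ rmorphM /= ratr_int (discrete_steiner_pointE (pE j)) mxE.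
rewrite polytope_dilate_mulmx lattice_sum_mulmx // /rat_coord mxE rmorph_sum.
rewrite horner_sum; apply: eq_bigr => j _.
by rewrite hornerZ -pE rmorphM.
Qed.

(** The translation contributes the term k x L(k), with L(k) the number of lattice
    points of kP; its linear coefficient is x because L(0) = 1. *)
Lemma discrete_steiner_translation :
  translation_equivariant (@discrete_steiner_point R n).
Proof.
move=> x P; apply/matrixP => r s; rewrite ord1 => {s}.
have [p pE] := lattice_sum_poly P r; have [q qE] := point_count_poly P.
rewrite (@discrete_steiner_pointE _ _ (p + (x r 0)%:~R *: ('X * q))) => [|k].
  rewrite coefD coefZ coefXM /= rmorphD rmorphM /= ratr_int.
  have := qE 0%N; rewrite /point_count lattice_total_dilate0 -horner_coef0 => <-.
  by rewrite rmorph1 mulr1 [in RHS]mxE (discrete_steiner_pointE pE) !mxE.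
rewrite polytope_dilate_translate lattice_sum_translate [LHS]raddfD /=.
rewrite hornerD -pE hornerZ hornerM hornerX -qE; congr (_ + _).
by rewrite raddfMz raddfMn /= -mulrzr mulrA mulr_natr.
Qed.

(** Write F(a, b) for the lattice sum of aP + bQ.  Newton's formula in a, with
    coefficients that are polynomial in b, gives F(a, b) as a finite sum of
    products B_i(a) q_i(b), and the derivative at 0 of F(k, k) is the sum of
    those of F(k, 0) and F(0, k) by the product rule. *)
Lemma discrete_steiner_additive : minkowski_additive (@discrete_steiner_point R n).
Proof.
move=> P Q; apply/matrixP => r s; rewrite ord1 [RHS]mxE => {s}.
pose F a b := rat_coord r (lattice_sum (polytope_add (polytope_dilate b Q) (polytope_dilate a P))).
have [M PM] := lattice_sum_fwd_diff_eq0 P r.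
have [N QN] := lattice_sum_fwd_diff_eq0 Q r.
have Fa b : forall k, iter M (@fwd_diff _) (fun a => F a b) k = 0 by exact: PM.
have /choice[q qE] : forall i : nat, exists q : {poly rat}, forall b : nat,
    iter i (@fwd_diff _) (fun a => F a b) 0%N = q.[b%:R].
  move=> i; apply: (@fwd_diff_poly _ N) => k.
  move: 0%N k; elim: i => [|i IHi] a k /=.
    rewrite -(QN (polytope_dilate a P) k); congr (iter _ _ _ _).
    by apply/funext => b; rewrite /F polytope_addC.
  by rewrite iter_fwd_diffB !IHi subrr.
have FE a b : F a b = \sum_(i < M) (bin_poly i).[a%:R] * (q i).[b%:R].
  rewrite (newton a (Fa b)); apply: eq_bigr => i _.
  by rewrite qE bin_polyE mulr_natl.
rewrite (@discrete_steiner_pointE _ _ (\sum_(i < M) bin_poly i * q i)) => [|k]; last first.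
  rewrite polytope_dilate_add polytope_addC -/(F k k) FE horner_sum.
  by apply: eq_bigr => i _; rewrite hornerM.
rewrite (@discrete_steiner_pointE P _ (\sum_(i < M) (q i)`_0 *: bin_poly i)) => [|k]; last first.
  rewrite -{1}(polytope_add_dilate0 (polytope_dilate k P) Q) -/(F k 0%N) FE horner_sum.
  by apply: eq_bigr => i _; rewrite [RHS]hornerZ -horner_coef0 [RHS]mulrC.
rewrite (@discrete_steiner_pointE Q _ (\sum_(i < M) (bin_poly i)`_0 *: q i)) => [|k]; last first.
  rewrite -{1}(polytope_add_dilate0 (polytope_dilate k Q) P) polytope_addC -/(F 0%N k) FE horner_sum.
  by apply: eq_bigr => i _; rewrite [RHS]hornerZ -horner_coef0.
rewrite -rmorphD !coef_sum -big_split; congr ratr; apply: eq_bigr => i _ /=.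
move: (bin_poly i) (q i) => b c; rewrite !coefZ coefM !big_ord_recl big_ord0 addr0 /=.
by rewrite addrC; congr (_ + _); rewrite mulrC.
Qed.

End SteinerPolynomial.

(** * Separation and support functions *)

Section Gordan.
Variables (R : realFieldType) (n : nat).
Implicit Types u x y : 'cV[R]_n.

Definition dot u x : R := (u^T *m x) 0 0.

Lemma dotC u x : dot u x = dot x u.
Proof. by rewrite /dot -[u^T *m x]trmxK trmx_mul trmxK mxE. Qed.

Lemma dotDr u x y : dot u (x + y) = dot u x + dot u y.
Proof. by rewrite /dot mulmxDr mxE. Qed.

Lemma dotZr u x (t : R) : dot u (t *: x) = t * dot u x.
Proof. by rewrite /dot -scalemxAr mxE. Qed.

Lemma dotBr u x y : dot u (x - y) = dot u x - dot u y.
Proof. by rewrite -scaleN1r dotDr dotZr mulN1r. Qed.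

Lemma dotDl u v x : dot (u + v) x = dot u x + dot v x.
Proof. by rewrite dotC dotDr !(dotC x). Qed.

Lemma dotZl u x (t : R) : dot (t *: u) x = t * dot u x.
Proof. by rewrite dotC dotZr dotC. Qed.

Lemma dotBl u v x : dot (u - v) x = dot u x - dot v x.
Proof. by rewrite dotC dotBr !(dotC x). Qed.

Lemma dot0r u : dot u 0 = 0.
Proof. by rewrite /dot mulmx0 mxE. Qed.

Lemma dot_sumr u (I : finType) (f : I -> 'cV[R]_n) :
  dot u (\sum_i f i) = \sum_i dot u (f i).
Proof. by rewrite /dot mulmx_sumr summxE. Qed.

Lemma dot_gt0 y : y != 0 -> 0 < dot y y.
Proof.
move=> y0; have dE : dot y y = \sum_i y i 0 ^+ 2.
  by rewrite /dot mxE; apply: eq_bigr => i _; rewrite mxE expr2.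
rewrite lt_neqAle dE sumr_ge0 ?andbT => [|i _]; last exact: sqr_ge0.
apply: contra y0; rewrite eq_sym psumr_eq0 => [|i _]; last exact: sqr_ge0.
move=> /allP h; apply/eqP/matrixP => i j; rewrite ord1 mxE.
by have := h i (mem_index_enum _); rewrite /= sqrf_eq0 => /eqP.
Qed.

(** Used to tilt a functional that vanishes on one vector until it becomes
    positive there, while keeping it positive on the others. *)
Lemma small_perturbation (I : finType) (a b : I -> R) : (forall i, 0 < a i) ->
  exists2 e, 0 < e & forall i, 0 < a i + e * b i.
Proof.
move=> a0; pose T := 1 + \sum_i `|b i| / a i.
have ba0 i : 0 <= `|b i| / a i by rewrite divr_ge0 // ltW.
have T0 : 0 < T by rewrite ltr_pwDl // sumr_ge0.
exists T^-1; first by rewrite invr_gt0.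
move=> i; have : `|b i| / a i < T.
  by rewrite /T (bigD1 i) //= addrCA ltrDl ltr_pwDl // sumr_ge0.
rewrite ltr_pdivrMr // => h.
rewrite -(pmulr_rgt0 _ T0) mulrDr mulrA mulfV ?gt_eqF // mul1r.
by have := ler_norm (- b i); rewrite normrN; lra.
Qed.

(** Gordan's alternative, by induction on the number of vectors.  Project the
    other vectors X i orthogonally to the first one y.  A functional positive on the
    projections, made orthogonal to y and then tilted towards y, is positive on
    all the vectors.  A relation between the projections is a relation
    sum c_i X_i = t y; if t <= 0 it is a relation between the given vectors, and
    if t > 0 then any functional positive on the X i is positive on y. *)
Lemma gordan m (x : 'I_m -> 'cV[R]_n) :
  (exists c : 'I_m -> R, [/\ forall i, 0 <= c i, exists i, 0 < c i &
     \sum_i c i *: x i = 0]) \/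
  (exists u, forall i, 0 < dot u (x i)).
Proof.
elim: m x => [|m IHm] x; first by right; exists 0; case.
set y := x ord0; pose X i := x (lift ord0 i).
pose ext t (c : 'I_m -> R) i := if unlift ord0 i is Some j then c j else t.
have ext_sum t c : \sum_i ext t c i *: x i = t *: y + \sum_i c i *: X i.
  rewrite big_ord_recl /ext unlift_none; congr (_ + _).
  by apply: eq_bigr => i _; rewrite liftK.
have ext_ge0 t c : 0 <= t -> (forall i, 0 <= c i) -> forall i, 0 <= ext t c i.
  by move=> t0 c0 i; rewrite /ext; case: unlift.
have extl t c i : ext t c (lift ord0 i) = c i by rewrite /ext liftK.
have [y0|y0] := eqVneq y 0.
  left; exists (ext 1 (fun=> 0)); split.
  - exact: ext_ge0.
  - by exists ord0; rewrite /ext unlift_none.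
  - by rewrite ext_sum y0 scaler0 big1 ?addr0 // => i _; rewrite scale0r.
have d0 := dot_gt0 y0; have dn0 : dot y y != 0 by rewrite gt_eqF.
have [[c [c0 [j cj] cE]]|[u hu]] := IHm (fun i => X i - (dot (X i) y / dot y y) *: y).
  pose t := \sum_i c i * (dot (X i) y / dot y y).
  have XE : \sum_i c i *: X i = t *: y.
    move: cE; under eq_bigr do rewrite scalerBr scalerA.
    by rewrite sumrB -scaler_suml => /eqP; rewrite subr_eq0 => /eqP.
  have [t0|t0] := lerP t 0.
    left; exists (ext (- t) c); split.
    - by apply: ext_ge0 => //; rewrite oppr_ge0.
    - by exists (lift ord0 j); rewrite extl.
    - by rewrite ext_sum XE scaleNr addNr.
  have [[c' [c'0 [j' cj'] c'E]]|[u hu]] := IHm X.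
    left; exists (ext 0 c'); split.
    - exact: ext_ge0.
    - by exists (lift ord0 j'); rewrite extl.
    - by rewrite ext_sum scale0r add0r.
  right; exists u => i; case: (unliftP ord0 i) => [k ->|->]; first exact: hu.
  rewrite -(pmulr_rgt0 _ t0) -dotZr -XE dot_sumr (bigD1 j) //=.
  rewrite ltr_pwDl ?dotZr ?mulr_gt0 // sumr_ge0 // => i' _.
  by rewrite dotZr mulr_ge0 // ltW.
pose u0 := u - (dot u y / dot y y) *: y.
have u0X i : 0 < dot u0 (X i).
  have := hu i; rewrite dotBr dotBl dotZr dotZl (dotC (X i) y).
  by rewrite (_ : dot y (X i) / dot y y * dot u y = dot u y / dot y y * dot y (X i)) //; ring.
have u0y : dot u0 y = 0 by rewrite dotBl dotZl mulfVK // subrr.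
have [e e0 he] := small_perturbation (fun i => dot y (X i)) u0X.
right; exists (u0 + e *: y) => i; rewrite dotDl dotZl.
case: (unliftP ord0 i) => [k ->|->]; first exact: he.
by rewrite u0y add0r mulr_gt0.
Qed.

(** Gordan's alternative for the vectors p - v i. *)
Lemma separation m (v : 'I_m -> 'cV[R]_n) p :
  (exists c : 'rV[R]_m, [/\ forall i, 0 <= c 0 i, \sum_i c 0 i = 1 &
     p = \sum_i c 0 i *: v i]) \/
  (exists u, forall i, dot u (v i) < dot u p).
Proof.
have [[c [c0 [j cj] cE]]|[u hu]] := gordan (fun i => p - v i); last first.
  by right; exists u => i; rewrite -subr_gt0 -dotBr.
left; have T0 : 0 < \sum_i c i by rewrite (bigD1 j) //= ltr_pwDl // sumr_ge0.
have Tn0 : \sum_i c i != 0 by rewrite gt_eqF.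
exists (\row_i (c i / \sum_i c i)); split.
- by move=> i; rewrite mxE divr_ge0 // ltW.
- rewrite -(mulfV Tn0) mulr_suml; apply: eq_bigr => i _; by rewrite mxE.
- apply: (scalerI Tn0); rewrite scaler_sumr.
  move: cE; under eq_bigr do rewrite scalerBr.
  rewrite sumrB -scaler_suml => /eqP; rewrite subr_eq0 => /eqP ->.
  by apply: eq_bigr => i _; rewrite mxE scalerA mulrCA mulfV // mulr1.
Qed.

End Gordan.

Section Support.
Variables (R : realType) (n : nat).
Implicit Types P Q : lattice_polytope R n.

Definition support (u : 'cV[R]_n) P : R := sup [set dot u x | x in polytope_set P].

Lemma support_max u P x : polytope_set P x ->
  (forall y, polytope_set P y -> dot u y <= dot u x) -> support u P = dot u x.
Proof.
move=> Px Pmax; apply/eqP; rewrite eq_le; apply/andP; split.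
  by apply: ge_sup => [|_ [y Py <-]]; [exists (dot u x), x|exact: Pmax].
apply: ub_le_sup; last by exists x.
by exists (dot u x) => _ [y Py <-]; exact: Pmax.
Qed.

Lemma support_attained u P : exists2 x, polytope_set P x &
  support u P = dot u x /\ forall y, polytope_set P y -> dot u y <= dot u x.
Proof.
have [m [v PE]] := polytope_family P.
pose i0 := [arg max_(i > ord0 : 'I_m.+1) dot u (lattice_vec (v i))]%O.
have Pi i : polytope_set P (lattice_vec (v i)).
  by rewrite PE; apply: sub_gen_smallest; exists i.
have max_i0 i : dot u (lattice_vec (v i)) <= dot u (lattice_vec (v i0)).
  by rewrite /i0; case: Order.TotalTheory.arg_maxP => //= j _ /(_ i); exact.
have Pmax y : polytope_set P y -> dot u y <= dot u (lattice_vec (v i0)).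
  rewrite PE => /convex_hull_rangeP[c [c0 c1 ->]]; rewrite dot_sumr.
  rewrite -[leRHS]mul1r -[X in X * _]c1 mulr_suml; apply: ler_sum => i _.
  by rewrite dotZr ler_wpM2l.
by exists (lattice_vec (v i0)) => //; split=> //; apply: support_max.
Qed.

Lemma le_support u P x : polytope_set P x -> dot u x <= support u P.
Proof. by have [y Py [-> h]] := support_attained u P; exact: h. Qed.

Lemma support_add u P Q : support u (polytope_add P Q) = support u P + support u Q.
Proof.
have [x Px [-> hx]] := support_attained u P; have [y Qy [-> hy]] := support_attained u Q.
rewrite -dotDr; apply: support_max; first by exists x => //; exists y.
by move=> _ [a Pa [b Qb <-]]; rewrite !dotDr lerD ?hx ?hy.
Qed.

(** A point of P outside Q would be strictly separated from Q. *)
Lemma support_subset P Q : (forall u, support u P <= support u Q) ->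
  polytope_set P `<=` polytope_set Q.
Proof.
move=> PQ p Pp; have [m [v QE]] := polytope_family Q.
have [|[u hu]] := separation (fun i => lattice_vec (v i)) p.
  by move=> /convex_hull_rangeP; rewrite QE.
have [y Qy [yE _]] := support_attained u Q.
have := le_trans (le_support u Pp) (PQ u); rewrite yE leNgt => /negP[].
move: Qy; rewrite QE => /convex_hull_rangeP[c [c0 c1 ->]]; rewrite dot_sumr.
rewrite -[ltRHS]mul1r -[X in X * _]c1 mulr_suml.
have [j cj] : exists j, c 0 j != 0.
  apply/existsP; rewrite -[X in is_true X]negbK negb_exists; apply/negP => /forallP h.
  move: c1; rewrite big1 => [/esym/eqP|i _]; first by rewrite oner_eq0.
  by have := h i; rewrite negbK => /eqP.
rewrite (bigD1 j) // [ltRHS](bigD1 j) //= ltr_leD //.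
  by rewrite dotZr ltr_pM2l // lt_neqAle eq_sym cj c0.
by apply: ler_sum => i _; rewrite dotZr ler_wpM2l // ltW.
Qed.

Lemma support_inj P Q : (forall u, support u P = support u Q) -> P = Q.
Proof.
move=> PQ; apply: lattice_polytope_inj; apply/seteqP.
by split; apply: support_subset => u; rewrite PQ.
Qed.

End Support.

(** * Alternating relations for additive functions *)

Lemma alt_map (I J : Type) (V : zmodType) (f : I -> J) (s : seq I) (phi : seq J -> V) :
  alt (map f s) phi = alt s (fun S => phi (map f S)).
Proof. by elim: s phi => //= i s IHs phi; rewrite !IHs. Qed.

(** For nonempty s the sum is minus the positive part of (min f) - b, and the
    hypothesis makes it vanish.  If f i <= b for the first index i, the two terms
    coincide, and otherwise the witness is in the tail and lies below b and
    below f i. *)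
Lemma alt_foldr_max (R : realType) (I : eqType) (f : I -> R) (b : R) (s : seq I) :
  (exists2 i, i \in s & f i <= b) ->
  alt s (fun S => foldr (fun i m => Num.max (f i) m) b S) = 0.
Proof.
elim: s b => [|i s IHs] b /= [j]; first by rewrite in_nil.
have foldr_max S : Num.max (f i) (foldr (fun i m => Num.max (f i) m) b S) =
    foldr (fun i m => Num.max (f i) m) (Num.max (f i) b) S.
  by elim: S => //= k S <-; rewrite maxCA.
rewrite (eq_alt (fun S _ => foldr_max S)) inE.
have [fib _ _|bfi] := leP (f i) b; first by rewrite subrr.
move=> /orP[/eqP->|js] fb; first by rewrite leNgt bfi in fb.
by rewrite !IHs ?subrr //; exists j => //; apply: le_trans fb (ltW bfi).
Qed.

(** P and Q are, up to a common summand, the Minkowski sums of the terms of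
    positive and of negative sign.  That they do not depend on f allows the same
    pair to be used for the support functions and for w. *)
Lemma alt_additive (R : realType) (n : nat) (I : Type) (s : seq I)
    (Phi : seq I -> lattice_polytope R n) :
  exists P Q, forall (V : zmodType) (f : lattice_polytope R n -> V),
    (forall P' Q', f (polytope_add P' Q') = f P' + f Q') ->
    alt s (fun S => f (Phi S)) = f P - f Q.
Proof.
elim: s Phi => [|i s IHs] Phi.
  exists (polytope_add (Phi [::]) (Phi [::])), (Phi [::]) => V f fD.
  by rewrite fD addrK.
have [P1 [Q1 h1]] := IHs Phi; have [P2 [Q2 h2]] := IHs (fun S => Phi (i :: S)).
exists (polytope_add P1 Q2), (polytope_add Q1 P2) => V f fD.
by rewrite /= (h1 _ _ fD) (h2 _ _ fD) !fD opprB addrACA -opprD.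
Qed.

Section Hulls.
Variables (R : realType) (n : nat).
Implicit Types (s A B : seq 'cV[int]_n) (P Q : lattice_polytope R n).

Lemma lattice_hull_subproof s : is_lattice_polytope
  (convex_hull (@lattice_vec R n @` [set` head 0 s :: s])).
Proof.
exists [set` head 0 s :: s]; split=> //; first by apply/finite_seqP; exists (head 0 s :: s).
by exists (head 0 s) => /=; rewrite mem_head.
Qed.

(** Prefixing the head gives a nonempty set of points also for the empty list, and
    changes nothing for the others ([lattice_hullE]). *)
Definition lattice_hull s : lattice_polytope R n :=
  LatticePolytope (lattice_hull_subproof s).

Lemma lattice_hullE s : s != [::] ->
  lattice_hull s = convex_hull (@lattice_vec R n @` [set` s]) :> set 'cV[R]_n.
Proof.
case: s => // a s _; congr convex_hull; congr image.
apply/seteqP; split=> y /=; last by rewrite [in X in _ -> X]inE => ->; rewrite orbT.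
by rewrite inE => /orP[/eqP->|//]; exact: mem_head.
Qed.

Lemma eq_lattice_hull s s' : s != [::] -> s =i s' -> lattice_hull s = lattice_hull s'.
Proof.
move=> s0 ss'; have s'0 : s' != [::].
  by case: s s0 ss' => // a s _; case: s' => // /(_ a); rewrite mem_head.
apply: lattice_polytope_inj; rewrite !lattice_hullE //; congr convex_hull; congr image.
by apply/seteqP; split=> x /=; rewrite ss'.
Qed.

Lemma polytope_hull P : exists2 s, s != [::] & P = lattice_hull s.
Proof.
have [S [/finite_seqP[s ->] [x xs] PE]] := polytope_setP P.
have s0 : s != [::] by case: (s) xs.
by exists s => //; apply: lattice_polytope_inj; rewrite lattice_hullE.
Qed.

Lemma lattice_hull_image s (f : 'cV[R]_n -> 'cV[R]_n) (g : 'cV[int]_n -> 'cV[int]_n) :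
  s != [::] -> affine_map f -> (forall x, f (lattice_vec x) = lattice_vec (g x)) ->
  polytope_set (lattice_hull (map g s)) = f @` polytope_set (lattice_hull s).
Proof.
move=> s0 ff fg; have gs0 : map g s != [::] by case: (s) s0.
rewrite !lattice_hullE // convex_hull_image //; congr convex_hull.
rewrite image_comp; apply/seteqP; split=> [_ [y /= /mapP[x xs ->] <-]|_ [y ys <-]].
  by exists x => //=; rewrite fg.
by exists (g y) => /=; [exact: map_f|rewrite fg].
Qed.

Lemma lattice_hull_mulmx s (phi : 'M[int]_n) : s != [::] ->
  polytope_mulmx phi (lattice_hull s) = lattice_hull (map (mulmx phi) s).
Proof.
move=> s0; apply: lattice_polytope_inj.
rewrite (lattice_hull_image (f := fun x => map_mx intr phi *m x) s0) //.
- by move=> x y t; rewrite mulmxDr -!scalemxAr.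
- by move=> x; rewrite /lattice_vec map_mxM.
Qed.

Lemma lattice_hull_translate s (t : 'cV[int]_n) : s != [::] ->
  polytope_translate (lattice_hull s) t = lattice_hull (map (fun x => x + t) s).
Proof.
move=> s0; apply: lattice_polytope_inj.
rewrite (lattice_hull_image (f := fun x => x + lattice_vec t) s0) //.
- move=> x y c.
  by rewrite !scalerDr addrACA -scalerDl [c + _]addrC subrK scale1r.
- by move=> x; rewrite /lattice_vec map_mxD.
Qed.

Lemma mem_lattice_hull s a : a \in s -> polytope_set (lattice_hull s) (lattice_vec a).
Proof.
by move=> sa; apply: sub_gen_smallest; exists a => //=; rewrite inE sa orbT.
Qed.

Lemma support_hull_cons u a s : s != [::] ->
  support u (lattice_hull (a :: s)) =
  Num.max (dot u (lattice_vec a)) (support u (lattice_hull s)).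
Proof.
move=> s0; set M := Num.max _ _.
have ub x : polytope_set (lattice_hull (a :: s)) x -> dot u x <= M.
  move: x; rewrite lattice_hullE //; apply: (@smallest_sub _ _ _ [set x | dot u x <= M]).
    by apply/convexP => x y t t0 t1 /= xM yM; rewrite dotDr !dotZr; nra.
  move=> _ [x /= + <-]; rewrite inE => /orP[/eqP-> |xs]; first by rewrite /= /M le_max lexx.
  by rewrite /= /M le_max (le_support _ (mem_lattice_hull xs)) orbT.
apply/eqP; rewrite eq_le; apply/andP; split.
  by have [x Px [-> _]] := support_attained u (lattice_hull (a :: s)); exact: ub.
rewrite /M ge_max (le_support _ (mem_lattice_hull (mem_head _ _))) /=.
have [x + [-> _]] := support_attained u (lattice_hull s).
rewrite lattice_hullE // => hx; apply: le_support.
suff : convex_hull (@lattice_vec R n @` [set` s]) `<=`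
    polytope_set (lattice_hull (a :: s)) by exact.
rewrite lattice_hullE //; apply: smallest_sub.
  by apply/convexP => y z t t0 t1; apply: convex_hullP.
move=> _ [y /= ys <-]; apply: sub_gen_smallest.
by exists y => //=; rewrite inE ys orbT.
Qed.

(** The hypothesis on u holds as soon as conv A and conv B have a common point.
    By [alt_foldr_max] the support functions satisfy the relation, so the two
    Minkowski sums of [alt_additive] are equal. *)
Lemma alt_hull_additive (V : zmodType) (w : lattice_polytope R n -> V) A B :
  (forall P Q, w (polytope_add P Q) = w P + w Q) -> B != [::] ->
  (forall u : 'cV[R]_n, exists2 a, a \in A & exists2 b, b \in B &
     dot u (lattice_vec a) <= dot u (lattice_vec b)) ->
  alt A (fun S => w (lattice_hull (S ++ B))) = 0.
Proof.
move=> wD B0 hAB.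
have [P [Q PQ]] := alt_additive A (fun S => lattice_hull (S ++ B)).
rewrite (PQ _ _ wD); apply/eqP; rewrite subr_eq0; apply/eqP; congr w.
apply: support_inj => u; apply/eqP; rewrite -subr_eq0; apply/eqP.
rewrite -(PQ _ (support u)); last exact: support_add.
have [a aA [b bB ab]] := hAB u.
rewrite -[RHS](@alt_foldr_max R _ (fun a => dot u (lattice_vec a)) (support u (lattice_hull B)) A).
  apply: eq_alt => S _; elim: S => //= c S <-.
  by rewrite support_hull_cons //; case: (S).
by exists a => //; apply: le_trans ab (le_support _ (mem_lattice_hull bB)).
Qed.

(** The affine dependence says that the convex hulls of the points with positive
    and with negative coefficients meet.  If some u were larger on all of pos
    than its maximum b over nonpos, all the terms l t * (u . v t - b) would be
    nonnegative with sum 0, forcing all coefficients to be 0. *)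
Lemma radon_relation (V : zmodType) (w : lattice_polytope R n -> V)
    (T : finType) (v : T -> 'cV[int]_n) (l : T -> R) (pos nonpos : seq T) :
  (forall P Q, w (polytope_add P Q) = w P + w Q) ->
  \sum_t l t = 0 -> \sum_t l t *: lattice_vec (v t) = 0 :> 'cV[R]_n ->
  (exists t, l t != 0) ->
  (forall t, t \in pos -> 0 < l t) -> (forall t, t \in nonpos -> l t <= 0) ->
  (forall t, t \in pos ++ nonpos) ->
  alt pos (fun S => w (lattice_hull (map v (S ++ nonpos)))) = 0.
Proof.
move=> wD l0 lv0 [t0 lt0] posP nonposP cover.
have [t2 nt2] : exists t, t \in nonpos.
  apply/not_existsP => h.
  have lpos t : 0 < l t.
    by apply: posP; have := cover t; rewrite mem_cat => /orP[//|/h].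
  suff : 0 < \sum_t l t by rewrite l0 ltxx.
  by rewrite (bigD1 t0) //= ltr_pwDl // sumr_ge0 // => t _; exact: ltW.
under eq_alt do rewrite map_cat.
rewrite -(alt_map v pos (fun S => w (lattice_hull (S ++ map v nonpos)))).
apply: alt_hull_additive => //; first by case: (nonpos) nt2.
move=> u; pose f t := dot u (lattice_vec (v t)).
pose t1 := [arg max_(t > t2 in nonpos) f t]%O.
have [t1n t1max] : t1 \in nonpos /\ forall t, t \in nonpos -> f t <= f t1.
  by rewrite /t1; case: Order.TotalTheory.arg_maxP.
suff [t tpos ft] : exists2 t, t \in pos & f t <= f t1.
  by exists (v t); [exact: map_f|exists (v t1) => //; exact: map_f].
apply: contrapT => /forall2NP h.
have term_ge0 t : 0 <= l t * (f t - f t1).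
  have := cover t; rewrite mem_cat => /orP[tp|tn].
    rewrite mulr_ge0 ?ltW ?posP // subr_gt0.
    by have [//|/negP] := h t; rewrite -ltNge.
  by rewrite mulr_le0 ?nonposP // subr_le0 t1max.
have sum0 : \sum_t l t * (f t - f t1) = 0.
  under eq_bigr do rewrite mulrBr -dotZr.
  by rewrite sumrB -dot_sumr lv0 dot0r -mulr_suml l0 mul0r subr0.
have term0 t : l t * (f t - f t1) = 0.
  by have /allP/(_ t (mem_index_enum _))/eqP :=
    (etrans (esym (psumr_eq0 _ (fun t _ => term_ge0 t))) (introT eqP sum0)).
have npos t : t \notin pos.
  apply/negP => tp; have /eqP := term0 t.
  have [//|/negP] := h t; rewrite -ltNge => lt_f.
  by rewrite mulf_eq0 subr_eq0 !gt_eqF // posP.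
have lneg t : l t <= 0.
  by apply: nonposP; have := cover t; rewrite mem_cat (negbTE (npos t)).
have : \sum_t - l t == 0 by rewrite sumrN l0 oppr0.
rewrite psumr_eq0 => [|t _]; last by rewrite oppr_ge0.
by move=> /allP/(_ t0 (mem_index_enum _)); rewrite /= oppr_eq0 (negbTE lt0).
Qed.

End Hulls.

(** * Integer matrices with an integer left inverse *)

(** Sylvester's identity; it computes the determinants of all the
    low-rank perturbations of the identity below. *)
Lemma det_1D_mulmxC (K : comNzRingType) m n (A : 'M[K]_(m, n)) (B : 'M[K]_(n, m)) :
  \det (1%:M + A *m B) = \det (1%:M + B *m A).
Proof.
have E : block_mx 1%:M 0 (- B) 1%:M *m block_mx 1%:M A 0 (1%:M + B *m A) =
         block_mx 1%:M A 0 1%:M *m block_mx (1%:M + A *m B) 0 (- B) 1%:M.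
  rewrite !mulmx_block ?(mul1mx, mul0mx, mulmx0, mulmx1) !(addr0, add0r) mulmxN mulNmx.
  by rewrite addrK addrCA addNr addr0.
have := congr1 determinant E.
by rewrite !det_mulmx !det_ublock !det_lblock !det1 !mul1r mulr1 => ->.
Qed.

Lemma norm_of_intmul_eq1 (a b : int) : a * b = 1 -> `|a| = 1.
Proof.
move=> ab; have /eqP : (absz a * absz b)%N = 1%N by rewrite -abszM ab.
by rewrite muln_eq1 -abszE => /andP[/eqP-> _].
Qed.

Section SmithDichotomy.
Variables (R : realType).

(** Either the columns of N span a saturated sublattice, and N has a left
    inverse, or some lattice point is a nonintegral combination of the columns.
    In Smith normal form N = L D S the first case means that the diagonal entries
    are units; otherwise a column of L is the required point. *)
Lemma smith_dichotomy n d (N : 'M[int]_(n, d)) :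
  (forall c : 'cV[R]_d, map_mx intr N *m c = 0 -> c = 0) ->
  (exists C : 'M[int]_(d, n), C *m N = 1%:M) \/
  (exists (y : 'cV[int]_n) (q : 'cV[R]_d), lattice_vec y = map_mx intr N *m q /\
     ~ exists c : 'cV[int]_d, q = lattice_vec c).
Proof.
move=> inj_N; have [L uL [S uS [e _ NE]]] := int_Smith_normal_form N.
set D := \matrix_(i, j) _ in NE.
have DE i j : D i j = e`_i *+ (i == j :> nat) by rewrite mxE.
pose Sr := map_mx intr S : 'M[R]_d.
have uSr : Sr \in unitmx.
  rewrite unitmxE det_map_mx /= unitfE intr_eq0.
  by move: uS; rewrite unitmxE; apply: contraTneq => ->; rewrite unitr0.
have NSE : map_mx intr N *m invmx Sr = map_mx intr L *m map_mx intr D :> 'M[R]_(n, d).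
  by rewrite NE !map_mxM -mulmxA mulmxV // mulmx1.
have D_neq0 (j : 'I_d) : exists2 i : 'I_n, i = j :> nat & e`_i != 0.
  apply: contrapT => h; have : invmx Sr *m delta_mx j 0 = 0 :> 'cV[R]_d.
    apply: inj_N; rewrite mulmxA NSE -mulmxA.
    suff -> : map_mx intr D *m delta_mx j 0 = 0 :> 'cV[R]_n by rewrite mulmx0.
    rewrite -colE; apply/matrixP => i k; rewrite !mxE.
    have [ij|//] := eqVneq (i : nat) j; rewrite mulr1n.
    by have [->//|ei] := eqVneq e`_i 0; case: h; exists i.
  move=> /(congr1 (mulmx Sr)); rewrite mulKVmx // mulmx0 => /matrixP/(_ j 0).
  by rewrite !mxE !eqxx => /eqP; rewrite oner_eq0.
have [unit_e|] := pselect (forall j : 'I_d, `|e`_j| = 1).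
  left; exists (invmx S *m D^T *m invmx L).
  suff DD : D^T *m D = 1%:M.
    by rewrite NE !mulmxA mulmxKV // -(mulmxA _ D^T) DD mulmx1 mulVmx.
  apply/matrixP => j k; rewrite !mxE.
  have [i ij _] := D_neq0 j; rewrite (bigD1 i) //= big1 ?addr0 => [|i' ii'].
    rewrite !mxE ij eqxx mulr1n; have [->|jk] := eqVneq j k.
      by rewrite eqxx mulr1n -expr2 -real_normK ?num_real // unit_e expr1n.
    by rewrite (inj_eq val_inj) (negbTE jk) mulr0.
  rewrite !mxE; have [i'j|_] := eqVneq (i' : nat) j; last by rewrite mul0r.
  by case/eqP: ii'; apply: val_inj; rewrite /= i'j ij.
move=> /existsNP[j ej]; right.
have [i ij ei] := D_neq0 j.
exists (col i L), ((e`_i)%:~R^-1 *: (invmx Sr *m delta_mx j 0)); split.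
  have e0 : (e`_i)%:~R != 0 :> R by rewrite intr_eq0.
  rewrite -scalemxAr mulmxA NSE -mulmxA -colE.
  have -> : col j (map_mx intr D) = (e`_i)%:~R *: delta_mx i 0 :> 'cV[R]_n.
    apply/matrixP => i' k; rewrite !mxE ord1 eqxx andbT -ij.
    by rewrite -val_eqE; case: eqP => [->|_]; rewrite ?mulr1 // mulr0n mulr0.
  by rewrite -scalemxAr scalerA mulVf // scale1r -colE /lattice_vec map_col.
move=> [c /(congr1 (fun x => Sr *m ((e`_i)%:~R *: x)))].
rewrite scalerA mulfV ?intr_eq0 // scale1r mulKVmx // -scalemxAr -map_mxM.
move=> /matrixP/(_ j 0); rewrite !mxE !eqxx -(rmorph1 (intr : int -> R)).
rewrite -rmorphM => /intr_inj/esym/norm_of_intmul_eq1; rewrite ij; exact: ej.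
Qed.

End SmithDichotomy.

(** * Unimodular simplices *)

Section VertexSwap.
Variables (K : comNzRingType) (d : nat).
Implicit Types (a b : 'I_d) (x : 'cV[K]_d).

(** The linear part of the affine map that exchanges the vertices 0 and e_a of the
    standard simplex and fixes the other vertices.  Written as a rank-one
    perturbation, its determinant -1 comes from Sylvester's identity. *)
Definition swap_mx a : 'M[K]_d :=
  1%:M + (- delta_mx a 0) *m (const_mx 1 + delta_mx 0 a : 'rV_d).

(** The linear form whose kernel is the mirror of the reflection [swap_mx a]. *)
Definition swap_weight a x : K := \sum_i x i 0 + x a 0.

Lemma swap_mxE a x : swap_mx a *m x = x - swap_weight a x *: delta_mx a 0.
Proof.
rewrite /swap_mx mulmxDl mul1mx mulNmx mulNmx -mulmxA; congr (_ - _).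
have -> : (const_mx 1 + delta_mx 0 a) *m x = (swap_weight a x)%:M.
  rewrite [LHS]mx11_scalar mulmxDl -rowE !mxE; congr (_ + _)%:M.
  by apply: eq_bigr => i _; rewrite mxE mul1r.
by rewrite mul_mx_scalar.
Qed.

Lemma swap_weight_delta a b : swap_weight a (delta_mx b 0) = 1 + (a == b)%:R.
Proof.
rewrite /swap_weight (bigD1 b) //= big1 => [|i ib]; first by rewrite !mxE !eqxx !andbT addr0.
by rewrite mxE (negbTE ib).
Qed.

Lemma det_swap_mx a : \det (swap_mx a) = - 1.
Proof.
rewrite /swap_mx det_1D_mulmxC mulmxN -colE det_mx11 !mxE !eqxx.
by rewrite opprD addrA subrr add0r.
Qed.

Definition vertex_swap a x := swap_mx a *m x + delta_mx a 0.

Lemma swap_weightB a x y : swap_weight a (x - y) = swap_weight a x - swap_weight a y.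
Proof.
rewrite /swap_weight !mxE opprD addrACA -sumrB; congr (_ + _).
by apply: eq_bigr => i _; rewrite !mxE.
Qed.

Lemma swap_weightZ a x t : swap_weight a (t *: x) = t * swap_weight a x.
Proof.
rewrite /swap_weight !mxE mulrDr mulr_sumr; congr (_ + _).
by apply: eq_bigr => i _; rewrite mxE.
Qed.

Lemma swap_mxK a : involutive (fun x => swap_mx a *m x).
Proof.
move=> x; rewrite !swap_mxE swap_weightB swap_weightZ swap_weight_delta eqxx.
rewrite -addrA -opprD -scalerDl [X in X *: _](_ : _ = 0) ?scale0r ?subr0 //=.
by rewrite mulr1n; ring.
Qed.

Lemma swap_mx_delta a : swap_mx a *m delta_mx a 0 = - delta_mx a 0 :> 'cV[K]_d.
Proof.
by rewrite swap_mxE swap_weight_delta eqxx scalerDl !scale1r opprD addrA subrr add0r.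
Qed.

Lemma vertex_swapK a : involutive (vertex_swap a).
Proof.
by move=> x; rewrite /vertex_swap mulmxDr swap_mxK swap_mx_delta subrK.
Qed.

Definition unit_simplex : seq 'cV[K]_d :=
  0 :: [seq delta_mx j 0 | j <- enum 'I_d].

Lemma vertex_swap_simplex a x : x \in unit_simplex -> vertex_swap a x \in unit_simplex.
Proof.
have delta_in j : delta_mx j 0 \in unit_simplex.
  by rewrite inE; apply/orP; right; apply/mapP; exists j; rewrite ?mem_enum.
rewrite inE => /orP[/eqP->|/mapP[j _ ->]].
  by rewrite /vertex_swap mulmx0 add0r.
rewrite /vertex_swap; have [->|aj] := eqVneq a j.
  by rewrite swap_mx_delta addNr mem_head.
by rewrite swap_mxE swap_weight_delta (negbTE aj) addr0 scale1r subrK.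
Qed.

Lemma map_vertex_swap a : [seq vertex_swap a x | x <- unit_simplex] =i unit_simplex.
Proof.
move=> x; apply/mapP/idP => [[y yU ->]|xU]; first exact: vertex_swap_simplex.
by exists (vertex_swap a x); rewrite ?vertex_swapK ?vertex_swap_simplex.
Qed.

End VertexSwap.

Lemma map_swap_mx (K L : comNzRingType) (f : {rmorphism K -> L}) d (a : 'I_d) :
  map_mx f (swap_mx K a) = swap_mx L a.
Proof.
rewrite map_mxD map_mxM map_mxN map_mxD map_mx1 map_const_mx !map_delta_mx.
by congr (_ + _ *m (const_mx _ + _)); exact: rmorph1.
Qed.

(** Products of two swaps are the 3-cycles of vertices, which have determinant 1.
    A vector fixed by them all has swap_weight a c *: e_a independent of a, which
    makes all the weights vanish when there are at least two directions. *)
Lemma swap_fixed (K : numFieldType) d (c : 'cV[K]_d) : (1 < d)%N ->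
  (forall a b, a != b -> swap_mx K a *m (swap_mx K b *m c) = c) -> c = 0.
Proof.
move=> d1 fix_c.
have eq_swap a b : a != b ->
    swap_weight a c *: delta_mx a 0 = swap_weight b c *: delta_mx b 0 :> 'cV[K]_d.
  move=> ab; have := congr1 (fun x => swap_mx K a *m x) (fix_c a b ab).
  by rewrite swap_mxK !swap_mxE => /addrI/oppr_inj.
have s0 a : swap_weight a c = 0.
  have [b ba] : exists b : 'I_d, b != a.
    have /card_gt1P[x [y [_ _ xy]]] : (1 < #|'I_d|)%N by rewrite card_ord.
    by have [xa|] := eqVneq x a; [exists y; rewrite -xa eq_sym|exists x].
  have := eq_swap a b; rewrite eq_sym => /(_ ba)/matrixP/(_ a 0).
  by rewrite !mxE !eqxx mulr1 eq_sym (negbTE ba) mulr0.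
have sum0 : \sum_i c i 0 = 0.
  have : \sum_a swap_weight a c = 0 by rewrite big1.
  rewrite big_split /= sumr_const card_ord -mulrSr => /eqP.
  by rewrite mulrn_eq0 /= => /eqP.
apply/matrixP => i j; rewrite ord1 mxE.
by have := s0 i; rewrite /swap_weight sum0 add0r.
Qed.

Section Unimodular.
Variables (R : realType) (n : nat) (w : lattice_polytope R n -> 'cV[R]_n).
Hypothesis n_gt1 : (1 < n)%N.
Hypothesis w_add : forall P Q, w (polytope_add P Q) = w P + w Q.
Hypothesis w_translate : forall P t, w (polytope_translate P t) = w P.
Hypothesis w_SL : SLZ_equivariant w.

Notation W s := (w (lattice_hull R s)).

(** Doubling a point is a translation. *)
Lemma hull_point a : W [:: a] = 0.
Proof.
have hullE : polytope_set (lattice_hull R [:: a]) = [set (lattice_vec a : 'cV[R]_n)].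
  rewrite lattice_hullE //; apply/seteqP; split.
    apply: smallest_sub => [|_ [x /= + <-]]; last by rewrite inE => /eqP->.
    apply/convexP => x y t _ _ /= -> ->.
    by rewrite -scalerDl [t + _]addrC subrK scale1r.
  by move=> _ ->; apply: sub_gen_smallest; exists a => //=; rewrite inE.
have : polytope_add (lattice_hull R [:: a]) (lattice_hull R [:: a]) =
    polytope_translate (lattice_hull R [:: a]) a.
  apply: lattice_polytope_inj; move: hullE; set P := lattice_hull _ _ => PE.
  rewrite -[LHS]/(minkowski_sum (polytope_set P) (polytope_set P)).
  rewrite -[RHS]/((fun x => x + lattice_vec a) @` polytope_set P) PE.
  apply/seteqP; split=> [_ [_ -> [_ -> <-]]|_ [_ -> <-]]; first by exists (lattice_vec a).
  by exists (lattice_vec a) => //; exists (lattice_vec a).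
move=> /(congr1 w); rewrite w_add w_translate => /eqP.
by rewrite -subr_eq0 addrK => /eqP.
Qed.

Lemma hull_translate s t : s != [::] -> W [seq x + t | x <- s] = W s.
Proof. by move=> s0; rewrite -lattice_hull_translate // w_translate. Qed.

Lemma hull_symmetry s (phi : 'M[int]_n) t : s != [::] -> \det phi = 1 ->
  [seq phi *m x + t | x <- s] =i s -> map_mx intr phi *m W s = W s.
Proof.
move=> s0 dphi sym; rewrite -w_SL // lattice_hull_mulmx //.
have ms0 : [seq phi *m x | x <- s] != [::] by case: (s) s0.
rewrite -(hull_translate t ms0) -map_comp; congr w; apply: eq_lattice_hull => //.
by case: (s) s0.
Qed.

(** An integer left inverse C of N makes it possible to write down elements of
    SL_n(Z) that prescribe the images of the columns of N, without completing
    them to a basis: 1 + N (G - 1) C acts on them through G and has the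
    determinant of G, and 1 + N Z (1 - N C) fixes them.  The latter shears force
    the value into the span of the columns, and the 3-cycles of vertices then
    force it to be 0.  A segment has no 3-cycle; it is reversed by an element
    of SL_n(Z) that is diagonal in a basis adapted to it, with two entries -1. *)
Lemma hull_unimodular d (N : 'M[int]_(n, d)) (C : 'M[int]_(d, n)) a :
  C *m N = 1%:M -> W [seq N *m e + a | e <- unit_simplex int d] = 0.
Proof.
move=> CN; pose s := [seq N *m e | e <- unit_simplex int d].
rewrite (_ : [seq _ | e <- _] = [seq x + a | x <- s]); last by rewrite -map_comp.
rewrite hull_translate //.
pose Nr := map_mx intr N : 'M[R]_(n, d); pose Cr := map_mx intr C : 'M[R]_(d, n).
have CNr : Cr *m Nr = 1%:M by rewrite -map_mxM CN map_mx1.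
case: d => [|d] in N C CN s Nr Cr CNr *.
  by rewrite /s /unit_simplex enum_ord0 /= hull_point.
have WE : W s = Nr *m (Cr *m W s).
  have shear (Z : 'M[int]_(d.+1, n)) : map_mx intr Z *m ((1%:M - Nr *m Cr) *m W s) = 0.
    pose phi := 1%:M + N *m (Z *m (1%:M - N *m C)).
    have phiN : phi *m N = N.
      rewrite mulmxDl mul1mx -!mulmxA mulmxBl mul1mx -!mulmxA CN mulmx1 subrr.
      by rewrite !mulmx0 addr0.
    have dphi : \det phi = 1.
      rewrite det_1D_mulmxC -mulmxA mulmxBl mul1mx -mulmxA CN mulmx1 subrr.
      by rewrite mulmx0 addr0 det1.
    have fix_w : map_mx intr phi *m W s = W s.
      apply: (@hull_symmetry s phi 0) => //.
      have -> // : [seq phi *m x + 0 | x <- s] = s.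
      by rewrite -map_comp; apply: eq_map => x /=; rewrite addr0 mulmxA phiN.
    have : map_mx intr (N *m (Z *m (1%:M - N *m C))) *m W s = 0.
      move: fix_w; rewrite map_mxD map_mx1 mulmxDl mul1mx -[RHS]addr0.
      by move/addrI.
    move=> /(congr1 (mulmx Cr)); rewrite !map_mxM map_mxB map_mx1 map_mxM mulmx0 -!mulmxA.
    by rewrite [LHS]mulmxA -/Nr -/Cr CNr mul1mx.
  apply/eqP; rewrite -subr_eq0 mulmxA -{1}[W s]mul1mx -mulmxBl; apply/eqP.
  apply/matrixP => i j; rewrite ord1 [RHS]mxE.
  have /matrixP/(_ 0 0) := shear (delta_mx 0 i).
  rewrite map_delta_mx [LHS]mxE (bigD1 i) //= big1 => [|k ki].
    by rewrite [delta_mx _ _ _ _]mxE !eqxx mul1r addr0 [RHS]mxE.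
  by rewrite [delta_mx _ _ _ _]mxE (negbTE ki) andbF mul0r.
have [d1|d1] := ltnP 1 d.+1.
  rewrite WE (_ : Cr *m W s = 0) ?mulmx0 //; apply: swap_fixed => // i j ij.
  pose G := swap_mx int i *m swap_mx int j.
  pose phi := 1%:M + N *m ((G - 1%:M) *m C).
  have phiN : phi *m N = N *m G.
    by rewrite mulmxDl mul1mx -!mulmxA CN mulmx1 mulmxBr mulmx1 addrC subrK.
  have dphi : \det phi = 1.
    rewrite det_1D_mulmxC -mulmxA CN mulmx1 addrC subrK det_mulmx !det_swap_mx.
    by rewrite mulrNN mulr1.
  have fix_w : map_mx intr phi *m W s = W s.
    apply: (@hull_symmetry s phi (N *m (swap_mx int i *m delta_mx j 0 + delta_mx i 0))) => //.
    move=> x; have -> : [seq phi *m x + N *m (swap_mx int i *m delta_mx j 0 + delta_mx i 0) | x <- s] =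
       [seq N *m e | e <- [seq vertex_swap i e | e <- [seq vertex_swap j e | e <- unit_simplex int d.+1]]].
      rewrite -!map_comp; apply: eq_map => e /=.
      rewrite mulmxA phiN -mulmxA -mulmxDr; congr (_ *m _).
      by rewrite /vertex_swap mulmxDr addrA -mulmxA.
    apply: eq_mem_map => y.
    by rewrite (eq_mem_map _ (map_vertex_swap j)) map_vertex_swap.
  have phiNr : map_mx intr phi *m Nr = Nr *m (swap_mx R i *m swap_mx R j).
    by rewrite -map_mxM phiN !map_mxM !map_swap_mx.
  transitivity (Cr *m (map_mx intr phi *m (Nr *m (Cr *m W s)))); last by rewrite -WE fix_w.
  by rewrite (mulmxA _ Nr) phiNr -(mulmxA Nr) (mulmxA Cr Nr) CNr mul1mx -mulmxA.
have d0 : d = 0%N by case: (d) d1.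
subst d; have [L uL [S uS [e _ NE]]] := int_Smith_normal_form N.
pose i0 : 'I_n := Ordinal (ltnW n_gt1).
pose i1 : 'I_n := Ordinal n_gt1.
pose J : 'M[int]_n := diag_mx (\row_i (if (i < 2)%N then -1 else 1)).
pose phi := L *m J *m invmx L.
have dphi : \det phi = 1.
  rewrite !det_mulmx mulrAC -det_mulmx mulmxV // det1 mul1r det_diag.
  rewrite (bigD1 i0) //= (bigD1 i1) //= big1 ?mxE ?mulr1 //= => i.
  rewrite -!val_eqE /= mxE => /andP[]; case: (i : nat) => [|[|]] //.
have phiN : phi *m N = - N.
  rewrite {1}NE !mulmxA mulmxKV // -(mulmxA _ J) NE -!mulmxA -mulmxN; congr (_ *m _).
  rewrite mulmxA -mulNmx; congr (_ *m _).
  apply/matrixP => i j; rewrite mul_diag_mx !mxE ord1.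
  by case: (i : nat) => [|k]; rewrite /= ?mulN1r ?mulr0 ?oppr0.
have fix_w : map_mx intr phi *m W s = W s.
  apply: (@hull_symmetry s phi (N *m delta_mx 0 0)) => //.
  have en : enum 'I_1 = [:: 0] by apply: (inj_map val_inj); rewrite val_enum_ord.
  rewrite /s /unit_simplex en /= !mulmx0 add0r mulmxA phiN mulNmx addNr.
  by move=> x; rewrite !inE orbC.
have phiNr : map_mx intr phi *m Nr = - Nr by rewrite -map_mxM phiN map_mxN.
have : W s = - W s.
  transitivity (map_mx intr phi *m (Nr *m (Cr *m W s))); first by rewrite -WE fix_w.
  by rewrite (mulmxA _ Nr) phiNr mulNmx -WE.
move=> /eqP; rewrite -addr_eq0 -mulr2n -scaler_nat scaler_eq0 pnatr_eq0 /=.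
by move/eqP.
Qed.

End Unimodular.

(** * Gram determinants and lattice points of simplices *)

Section Gram.
Variables (R : realType) (n : nat).

(** An extra coordinate 1 turns affine dependence of points into linear
    dependence of rows. *)
Definition homogenize k (v : 'I_k -> 'cV[int]_n) : 'M[int]_(k, n + 1) :=
  \matrix_i row_mx (v i)^T 1%:M.

Lemma homogenizel k (v : 'I_k -> 'cV[int]_n) i j : homogenize v i (lshift 1 j) = v i j 0.
Proof. by rewrite mxE row_mxEl mxE. Qed.

Lemma homogenizer k (v : 'I_k -> 'cV[int]_n) i j : homogenize v i (rshift n j) = 1.
Proof. by rewrite mxE row_mxEr mxE ord1. Qed.

(** For simplices in one affine subspace this is proportional to the squared
    volume, and it is an integer in every dimension. *)
Definition gram k (v : 'I_k -> 'cV[int]_n) : int :=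
  \det (homogenize v *m (homogenize v)^T).

Lemma mul_homogenize k (v : 'I_k -> 'cV[int]_n) (c : 'rV[R]_k) :
  c *m map_mx intr (homogenize v) =
  row_mx (\sum_i c 0 i *: lattice_vec (v i))^T (\sum_i c 0 i)%:M.
Proof.
apply/rowP => j; case: (split_ordP j) => j' ->.
  rewrite row_mxEl mxE [RHS]mxE summxE; apply: eq_bigr => i _.
  by rewrite [_ i _]mxE homogenizel !mxE.
rewrite row_mxEr mxE ord1 [RHS]mxE mulr1n; apply: eq_bigr => i _.
by rewrite [_ i _]mxE homogenizer mulr1.
Qed.

Lemma gramE k (v : 'I_k -> 'cV[int]_n) :
  (gram v)%:~R = \det (map_mx intr (homogenize v) *m (map_mx intr (homogenize v))^T) :> R.
Proof. by rewrite /gram -det_map_mx map_mxM matrix.map_trmx. Qed.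

Lemma affine_dependence k (v : 'I_k -> 'cV[int]_n) : gram v = 0 ->
  exists c : 'rV[R]_k, [/\ c != 0, \sum_i c 0 i = 0 &
    \sum_i c 0 i *: lattice_vec (v i) = 0 :> 'cV[R]_n].
Proof.
move=> gv0; have := gramE v; rewrite gv0 => /esym/eqP/det0P[c c0 cHH].
set H := map_mx intr (homogenize v) in cHH.
have : dot (c *m H)^T (c *m H)^T = 0.
  by rewrite /dot trmxK trmx_mul mulmxA -(mulmxA c) cHH mul0mx mxE.
move=> d0; have /eqP : (c *m H)^T == 0.
  by apply/negP => /negP /dot_gt0; rewrite d0 ltxx.
move=> /(congr1 trmx); rewrite trmxK trmx0 mul_homogenize -row_mx0.
move=> /eq_row_mx[/(congr1 trmx)]; rewrite trmxK trmx0 => cv cs.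
exists c; split=> //.
by move/matrixP: cs => /(_ 0 0); rewrite !mxE mulr1n.
Qed.

Lemma gram_eq0 k (v : 'I_k -> 'cV[int]_n) (c : 'rV[R]_k) : c != 0 ->
  \sum_i c 0 i = 0 -> \sum_i c 0 i *: lattice_vec (v i) = 0 :> 'cV[R]_n ->
  gram v = 0.
Proof.
move=> c0 cs cv; apply/eqP; rewrite -(intr_eq0 R) gramE; apply/det0P.
exists c => //; rewrite mulmxA mul_homogenize cs cv.
by rewrite (_ : 0%:M = 0) ?trmx0 ?row_mx0 ?mul0mx //; apply/matrixP => i j; rewrite !mxE mul0rn.
Qed.

Definition replace k (v : 'I_k -> 'cV[int]_n) i x j := if j == i then x else v j.

(** Only row i changes, into the combination of the rows with coefficients l, so the
    homogenized matrix is multiplied by a matrix of determinant l 0 i. *)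
Lemma gram_replace k (v : 'I_k -> 'cV[int]_n) i x (l : 'rV[R]_k) :
  \sum_j l 0 j = 1 -> \sum_j l 0 j *: lattice_vec (v j) = lattice_vec x :> 'cV[R]_n ->
  (gram (replace v i x))%:~R = l 0 i ^+ 2 * (gram v)%:~R :> R.
Proof.
move=> l1 lx; pose E : 'M[R]_k := 1%:M + delta_mx i 0 *m (l - delta_mx 0 i).
have detE : \det E = l 0 i.
  rewrite /E det_1D_mulmxC -colE det_mx11 !mxE !eqxx.
  by rewrite addrC subrK.
have HE : map_mx intr (homogenize (replace v i x)) =
    E *m map_mx intr (homogenize v) :> 'M[R]_(_, _).
  rewrite mulmxDl mul1mx -mulmxA mulmxBl mul_homogenize l1 lx -rowE.
  apply/matrixP => j p; rewrite [RHS]mxE [X in _ + X]mxE big_ord1 [delta_mx _ _ _ _]mxE andbT.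
  rewrite [X in _ = _ + _ * X]mxE [X in _ * (_ + X)]mxE [X in _ * (_ - X)]mxE.
  rewrite ![map_mx _ _ _ _]mxE.
  have [->|ji] := eqVneq j i; last first.
    rewrite mul0r addr0; case: (split_ordP p) => p' ->.
      by rewrite !homogenizel /replace (negbTE ji).
    by rewrite !homogenizer.
  rewrite mul1r addrCA subrr addr0; case: (split_ordP p) => p' ->.
    by rewrite row_mxEl !homogenizel /replace eqxx !mxE.
  by rewrite row_mxEr !homogenizer mxE (ord1 p') eqxx.
rewrite !gramE HE trmx_mul mulmxA -(mulmxA E) !det_mulmx det_tr detE.
by rewrite mulrAC -expr2.
Qed.
End Gram.

Section Fractions.
Variable R : realType.

Definition frac (x : R) := x - (Num.floor x)%:~R.

Lemma frac_ge0 x : 0 <= frac x.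
Proof. by rewrite subr_ge0 Num.Theory.floor_le. Qed.

Lemma frac_lt1 x : frac x < 1.
Proof. by rewrite ltrBlDr addrC -intrD1 Num.Theory.floorD1_gt. Qed.

Lemma frac_eq0 x : frac x = 0 -> x = (Num.floor x)%:~R.
Proof. by move=> /eqP; rewrite subr_eq0 => /eqP. Qed.

(** While the sum exceeds 1 some coefficient is positive, and lowering it by 1
    changes the point by a lattice vector and keeps |l t| < 1. *)
Lemma reduce_barycentric n (T : finType) (v : T -> 'cV[int]_n) (s : nat) (l : T -> R) :
  (forall t, `|l t| < 1) -> \sum_t l t = s.+1%:R ->
  (exists x, \sum_t l t *: lattice_vec (v t) = lattice_vec x :> 'cV[R]_n) ->
  exists2 l' : T -> R, (forall t, `|l' t| < 1) & \sum_t l' t = 1 /\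
  exists x, \sum_t l' t *: lattice_vec (v t) = lattice_vec x :> 'cV[R]_n.
Proof.
elim: s l => [|s IHs] l l1 ls [x lx]; first by exists l => //; split=> //; exists x.
have [t lt] : exists t, 0 < l t.
  apply: contrapT => /forallNP h; have : \sum_t l t <= 0.
    by apply: sumr_le0 => t _; rewrite leNgt; apply/negP.
  by rewrite ls leNgt ltr0Sn.
apply: (IHs (fun t' => l t' - (t' == t)%:R)).
- move=> t'; have [->|_] := eqVneq t' t; last by rewrite subr0.
  by have := l1 t; rewrite !ltr_norml => /andP[_ h]; rewrite /=; apply/andP; split; lra.
- rewrite sumrB ls (bigD1 t) //= eqxx big1 ?addr0 => [|t' /negbTE-> //].
  by rewrite -[s.+2%:R]natr1 addrK.
- exists (x - v t); rewrite /lattice_vec map_mxB -/(lattice_vec x) -lx.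
  under eq_bigr do rewrite scalerBl.
  rewrite sumrB; congr (_ - _); rewrite (bigD1 t) //= eqxx scale1r big1 ?addr0 //.
  by move=> t' /negbTE->; rewrite scale0r.
Qed.

(** Taking fractional parts of the barycentric coordinates of v_0 + y gives
    coefficients in [0, 1) whose sum is an integer, and positive because not all of
    them vanish; [reduce_barycentric] brings the sum down to 1. *)
Lemma noninteger_barycentric n k (v : 'I_k.+1 -> 'cV[int]_n) (y : 'cV[int]_n) (q : 'cV[R]_k) :
  lattice_vec y = \sum_j q j 0 *: lattice_vec (v (lift ord0 j) - v ord0) :> 'cV[R]_n ->
  ~ (exists c : 'cV[int]_k, q = lattice_vec c) ->
  exists2 l : 'I_k.+1 -> R, (forall t, `|l t| < 1) & \sum_t l t = 1 /\
  exists x, \sum_t l t *: lattice_vec (v t) = lattice_vec x :> 'cV[R]_n.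
Proof.
move=> yE q_nint; pose f j := frac (q j 0); pose F := \sum_j f j.
pose l i := if unlift ord0 i is Some j then f j else frac (- F).
have l0 : l ord0 = frac (- F) by rewrite /l unlift_none.
have lS j : l (lift ord0 j) = f j by rewrite /l liftK.
have l_ge0 t : 0 <= l t by rewrite /l; case: unlift => [j|]; exact: frac_ge0.
have l_lt1 t : l t < 1 by rewrite /l; case: unlift => [j|]; exact: frac_lt1.
have sum_l : \sum_t l t = (- Num.floor (- F))%:~R.
  rewrite big_ord_recl l0 (eq_bigr f) => [|j _]; last exact: lS.
  by rewrite -/F /frac addrAC addNr sub0r rmorphN.
have : 0 < \sum_t l t.
  rewrite lt_neqAle sumr_ge0 ?andbT //; apply/negP => /eqP/esym/eqP.
  rewrite psumr_eq0 // => /allP h; apply: q_nint.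
  exists (\col_j Num.floor (q j 0)); apply/matrixP => j p; rewrite ord1 !mxE.
  by apply: frac_eq0; have := h (lift ord0 j) (mem_index_enum _); rewrite lS => /eqP.
rewrite sum_l ltr0z => m0.
have [s sE] : exists s : nat, - Num.floor (- F) = s.+1%:Z.
  by case: (- _) m0 => [[|s]|s] // _; exists s.
apply: (@reduce_barycentric _ _ v s l).
- by move=> t; rewrite ger0_norm.
- by rewrite sum_l sE.
exists (y - \sum_j (v (lift ord0 j) - v ord0) *~ Num.floor (q j 0) + v ord0 *+ s.+1).
rewrite /lattice_vec map_mxD map_mxB raddfMn -/(lattice_vec y) yE raddf_sum /=.
have -> : \sum_t l t *: map_mx intr (v t) =
   \sum_j f j *: map_mx intr (v (lift ord0 j) - v ord0) + map_mx intr (v ord0) *+ s.+1 :> 'cV[R]_n.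
  have -> : map_mx intr (v ord0) *+ s.+1 = (\sum_t l t) *: map_mx intr (v ord0) :> 'cV[R]_n.
    by rewrite sum_l sE -scaler_nat.
  rewrite !big_ord_recl scalerDl addrCA; congr (_ + _).
  rewrite scaler_suml -big_split; apply: eq_bigr => j _ /=.
  by rewrite lS map_mxB scalerBr subrK.
congr (_ + _); rewrite -sumrB; apply: eq_bigr => j _.
by rewrite /f /frac scalerBl raddfMz /= scaler_int.
Qed.

End Fractions.

(** * Vanishing by induction *)

Section Vanishing.
Variables (R : realType) (n : nat) (w : lattice_polytope R n -> 'cV[R]_n).
Hypothesis n_gt1 : (1 < n)%N.
Hypothesis w_add : forall P Q, w (polytope_add P Q) = w P + w Q.
Hypothesis w_translate : forall P t, w (polytope_translate P t) = w P.
Hypothesis w_SL : SLZ_equivariant w.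

Notation W s := (w (lattice_hull R s)).

Lemma hull_nil : W [::] = 0.
Proof.
rewrite -(hull_point w_add w_translate 0); congr w; apply: lattice_polytope_inj => /=.
congr convex_hull; congr image; apply/seteqP; split=> x /=; rewrite !inE ?orbb //.
Qed.

Section Step.
Variables (k : nat) (v : 'I_k.+1 -> 'cV[int]_n).
Hypothesis fewer : forall s, (size s < k.+1)%N -> W s = 0.
Hypothesis smaller : forall v' : 'I_k.+1 -> 'cV[int]_n,
  (absz (gram v') < absz (gram v))%N -> W [seq v' i | i <- enum 'I_k.+1] = 0.

(** Radon's theorem: all the other terms of the relation are hulls of fewer
    points. *)
Lemma dependent_step : gram v = 0 -> W [seq v i | i <- enum 'I_k.+1] = 0.
Proof.
move=> /(affine_dependence R)[c [c0 cs cv]].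
pose pos := [seq i <- enum 'I_k.+1 | 0 < c 0 i].
pose nonpos := [seq i <- enum 'I_k.+1 | ~~ (0 < c 0 i)].
have perm_all : perm_eq (pos ++ nonpos) (enum 'I_k.+1).
  by rewrite perm_filterC.
have size_all : (size pos + size nonpos = k.+1)%N.
  by rewrite -size_cat (perm_size perm_all) size_enum_ord.
have rel : alt pos (fun S => W (map v (S ++ nonpos))) = 0.
  apply: (@radon_relation R n _ w _ v (c 0)) => //.
  - apply: contrapT => /forallNP h; case/eqP: c0; apply/rowP => i; rewrite mxE.
    by apply/eqP; have /negP := h i; rewrite negbK.
  - by move=> t; rewrite mem_filter => /andP[].
  - by move=> t; rewrite mem_filter -leNgt => /andP[].
  - by move=> t; rewrite (perm_mem perm_all) mem_enum.
have := alt_eq0_full _ rel => <-.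
  congr w; apply: eq_lattice_hull; first by rewrite enum_ordSl.
  by apply: eq_mem_map => i; rewrite (perm_mem perm_all).
move=> S sS ltS; apply: fewer; rewrite size_map size_cat.
by rewrite -[ltnRHS]size_all ltn_add2r.
Qed.

Section Exchange.
Variables (x : 'cV[int]_n) (l : 'I_k.+1 -> R).
Hypothesis gram_neq0 : gram v != 0.
Hypothesis l_lt1 : forall t, `|l t| < 1.
Hypothesis l_sum : \sum_t l t = 1.
Hypothesis l_x : \sum_t l t *: lattice_vec (v t) = lattice_vec x :> 'cV[R]_n.

(* Index 0 stands for the new point x, with coefficient -1, so that v' and l'
   form an affine dependence among the k.+2 points. *)
Let v' (i : 'I_k.+2) := if unlift ord0 i is Some j then v j else x.
Let l' (i : 'I_k.+2) := if unlift ord0 i is Some j then l j else -1.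

Let v'0 : v' ord0 = x. Proof. by rewrite /v' unlift_none. Qed.
Let v'S j : v' (lift ord0 j) = v j. Proof. by rewrite /v' liftK. Qed.
Let l'0 : l' ord0 = -1. Proof. by rewrite /l' unlift_none. Qed.
Let l'S j : l' (lift ord0 j) = l j. Proof. by rewrite /l' liftK. Qed.

Let l'_sum : \sum_t l' t = 0.
Proof.
rewrite big_ord_recl l'0 (eq_bigr l) => [|j _]; last exact: l'S.
by rewrite l_sum addNr.
Qed.

Let l'_v' : \sum_t l' t *: lattice_vec (v' t) = 0 :> 'cV[R]_n.
Proof.
rewrite big_ord_recl l'0 v'0 (eq_bigr (fun j => l j *: lattice_vec (v j))) => [|j _].
  by rewrite l_x scaleN1r addNr.
by rewrite l'S v'S.
Qed.

(** Such a list misses at least one of the v_i.  If it misses only one, it is the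
    simplex with v_i exchanged for x, of smaller Gram determinant. *)
Lemma replaced_vanish (U : seq 'I_k.+2) : uniq U -> (size U <= k.+1)%N ->
  ord0 \in U -> W (map v' U) = 0.
Proof.
move=> uU; rewrite leq_eqVlt => /orP[/eqP sU|ltU] U0; last by apply: fewer; rewrite size_map.
have cU : #|U| = k.+1 by rewrite (card_uniqP uU).
have [i0 i0U] : exists i0, i0 \notin U.
  apply/existsP; rewrite -negb_forall; apply/negP => /forallP h.
  have /eqP : #|U| = k.+2 by rewrite -[RHS]card_ord; apply: eq_card => i; rewrite h.
  by rewrite cU eqn_leq ltnn andbF.
have UE : U =i predC1 i0.
  apply/subset_cardP; first by rewrite cU cardC1 card_ord.
  by apply/fintype.subsetP => i iU; rewrite inE; apply: contraNneq i0U => <-.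
have [i i0E] : exists i, i0 = lift ord0 i.
  by case: (unliftP ord0 i0) => [j ->|i00]; [exists j|rewrite i00 U0 in i0U].
rewrite -(smaller (v' := replace v i x)).
  congr w; apply: eq_lattice_hull; first by case: (U) U0.
  move=> y; apply/mapP/mapP => -[j jU ->].
    case: (unliftP ord0 j) jU => [j' ->|->] jU; last first.
      by exists i; rewrite ?mem_enum // v'0 /replace eqxx.
    exists j'; rewrite ?mem_enum // v'S /replace.
    case: eqP => // j'i; move: jU; by rewrite UE i0E j'i !inE eqxx.
  rewrite /replace; have [_|ji] := eqVneq j i; first by exists ord0.
  exists (lift ord0 j) => //; rewrite UE i0E inE.
  by rewrite (inj_eq lift_inj).
rewrite -(ltr_nat R) !pmulrn !abszE !intr_norm.
rewrite (@gram_replace R n _ v i x (\row_j l j)).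
- rewrite normrM mxE gtr_pMl; last by rewrite normr_gt0 intr_eq0.
  by rewrite normrX expr_lt1.
- by rewrite -l_sum; apply: eq_bigr => j _; rewrite mxE.
- by rewrite -l_x; apply: eq_bigr => j _; rewrite mxE.
Qed.

(** The relation with x on the nonpositive side shows that w vanishes at the hull
    of all the k.+2 points.  In the relation for the opposite signs the only
    other term not covered by [replaced_vanish] or by fewer points is the hull of
    the v_i. *)
Lemma exchange_step : W [seq v i | i <- enum 'I_k.+1] = 0.
Proof.
pose pos := [seq lift ord0 i | i <- enum 'I_k.+1 & 0 < l i].
pose nonpos := [seq lift ord0 i | i <- enum 'I_k.+1 & ~~ (0 < l i)].
pose neg := [seq lift ord0 i | i <- enum 'I_k.+1 & l i < 0].
pose nonneg := [seq lift ord0 i | i <- enum 'I_k.+1 & ~~ (l i < 0)].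
have inj_lift : injective (lift (@ord0 k.+1)) by exact: lift_inj.
have lifted (p : pred 'I_k.+1) i :
    lift ord0 i \in [seq lift ord0 j | j <- enum 'I_k.+1 & p j] = p i.
  by rewrite mem_map // mem_filter mem_enum andbT.
have lifted0 (p : pred 'I_k.+1) : ord0 \notin [seq lift ord0 j | j <- enum 'I_k.+1 & p j].
  by apply/mapP => -[j _ /eqP]; rewrite (negbTE (neq_lift _ _)).
have perm_split (p : pred 'I_k.+1) :
   perm_eq ([seq lift ord0 j | j <- enum 'I_k.+1 & p j] ++
            [seq lift ord0 j | j <- enum 'I_k.+1 & ~~ p j])
           [seq lift ord0 j | j <- enum 'I_k.+1].
  by rewrite -map_cat perm_map // perm_filterC.
have size_split p : (size [seq lift ord0 j | j <- enum 'I_k.+1 & p j] +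
    size [seq lift ord0 j | j <- enum 'I_k.+1 & ~~ p j] = k.+1)%N.
  by rewrite -size_cat (perm_size (perm_split p)) size_map size_enum_ord.
have uniq_split p S : subseq S [seq lift ord0 j | j <- enum 'I_k.+1 & p j] ->
    uniq (ord0 :: S ++ [seq lift ord0 j | j <- enum 'I_k.+1 & ~~ p j]).
  move=> sS; apply: (subseq_uniq (s2 := ord0 :: [seq lift ord0 j | j <- enum 'I_k.+1 & p j] ++
     [seq lift ord0 j | j <- enum 'I_k.+1 & ~~ p j])).
    by rewrite /= ?eqxx cat_subseq.
  rewrite cons_uniq mem_cat negb_or !lifted0 (perm_uniq (perm_split p)).
  by rewrite map_inj_uniq // enum_uniq.
have l'_neq0 : exists t, l' t != 0 by exists ord0; rewrite l'0 oppr_eq0 oner_eq0.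
have all_vanish : W (map v' (pos ++ ord0 :: nonpos)) = 0.
  have rel : alt pos (fun S => W (map v' (S ++ ord0 :: nonpos))) = 0.
    apply: (@radon_relation R n _ w _ v' l') => //.
    - by move=> _ /mapP[i + ->]; rewrite mem_filter l'S => /andP[].
    - move=> t; rewrite inE => /orP[/eqP->|/mapP[i + ->]]; first by rewrite l'0 lerN10.
      by rewrite mem_filter l'S -leNgt => /andP[].
    - move=> t; rewrite mem_cat inE; case: (unliftP ord0 t) => [i ->|->]; last by rewrite eqxx orbT.
      by rewrite !lifted; case: (0 < l i); rewrite ?orbT.
  apply: (alt_eq0_full _ rel) => S sS ltS; apply: replaced_vanish.
  - by rewrite -cat1s uniq_catCA; exact: uniq_split.
  - by rewrite size_cat /= addnS -[leqRHS](size_split (fun i => 0 < l i)) ltn_add2r.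
  - by rewrite mem_cat mem_head orbT.
have rel : alt (ord0 :: neg) (fun S => W (map v' (S ++ nonneg))) = 0.
  apply: (@radon_relation R n _ w _ v' (fun t => - l' t)) => //.
  - by rewrite sumrN l'_sum oppr0.
  - by under eq_bigr do rewrite scaleNr; rewrite sumrN l'_v' oppr0.
  - by have [t lt] := l'_neq0; exists t; rewrite oppr_eq0.
  - move=> t; rewrite inE => /orP[/eqP->|/mapP[i + ->]]; first by rewrite l'0 opprK.
    by rewrite mem_filter l'S oppr_gt0 => /andP[].
  - by move=> _ /mapP[i + ->]; rewrite mem_filter l'S oppr_le0 -leNgt => /andP[].
  - move=> t; rewrite mem_cat inE; case: (unliftP ord0 t) => [i ->|->]; last by rewrite eqxx.
    by rewrite !lifted; case: (l i < 0); rewrite ?orbT.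
move: rel => /=; rewrite [X in _ - X](eq_alt (psi := fun=> 0)) ?alt0 ?subr0 => [rel|S sS]; last first.
  have := size_subseq sS; rewrite leq_eqVlt => /orP[/eqP eqS|ltS]; last first.
    apply: (@replaced_vanish (ord0 :: S ++ nonneg)); [exact: uniq_split| |exact: mem_head].
    by rewrite /= size_cat -[leqRHS](size_split (fun i => l i < 0)) ltn_add2r.
  have -> : S = neg by apply/eqP; rewrite -(size_subseq_leqif sS) eqS.
  rewrite -all_vanish; congr w; apply: eq_lattice_hull => //.
  apply: (@eq_mem_map _ _ v' (ord0 :: neg ++ nonneg)) => t; rewrite !(mem_cat, inE).
  case: (unliftP ord0 t) => [i ->|->]; last by rewrite eqxx orbT.
  by rewrite !lifted; case: (l i < 0); case: (0 < l i); rewrite ?orbT.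
have := alt_eq0_full _ rel => <-.
  congr w; apply: eq_lattice_hull; first by rewrite enum_ordSl.
  rewrite (_ : [seq v i | i <- _] = map v' [seq lift ord0 i | i <- enum 'I_k.+1]).
    by apply: eq_mem_map => t; rewrite (perm_mem (perm_split _)).
  by rewrite -map_comp; apply: eq_map => i /=; rewrite v'S.
move=> S sS ltS; apply: fewer; rewrite size_map size_cat.
by rewrite -[ltnRHS](size_split (fun i => l i < 0)) ltn_add2r.
Qed.

End Exchange.

(** Every configuration of points is affinely dependent, unimodular, or admits an
    exchange. *)
Lemma simplex_step : W [seq v i | i <- enum 'I_k.+1] = 0.
Proof.
have [g0|g0] := eqVneq (gram v) 0; first exact: dependent_step.
pose N : 'M[int]_(n, k) := \matrix_(i, j) (v (lift ord0 j) - v ord0) i 0.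
have NE (q : 'cV[R]_k) : map_mx intr N *m q =
    \sum_j q j 0 *: lattice_vec (v (lift ord0 j) - v ord0).
  apply/matrixP => i p; rewrite ord1 mxE summxE; apply: eq_bigr => j _.
  by rewrite !mxE mulrC.
have inj_N q : map_mx intr N *m q = 0 :> 'cV[R]_n -> q = 0.
  rewrite NE => q0; apply/eqP; apply: contraNT g0 => qn0.
  pose c : 'rV[R]_k.+1 := \row_i if unlift ord0 i is Some j then q j 0 else - \sum_j q j 0.
  have c0 : c 0 ord0 = - \sum_j q j 0 by rewrite mxE unlift_none.
  have cS j : c 0 (lift ord0 j) = q j 0 by rewrite mxE liftK.
  apply/eqP/(@gram_eq0 R _ _ v c).
  - apply: contra qn0 => /eqP c00; apply/eqP/matrixP => j p.
    by rewrite ord1 -cS c00 !mxE.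
  - rewrite big_ord_recl c0 [X in _ + X](eq_bigr (fun j => q j 0)) ?addNr // => j _; exact: cS.
  - rewrite big_ord_recl c0 (eq_bigr (fun j => q j 0 *: lattice_vec (v (lift ord0 j)))) => [|j _].
      rewrite scaleNr scaler_suml addrC -sumrB -[RHS]q0; apply: eq_bigr => j _.
      by rewrite -scalerBr /lattice_vec map_mxB.
    by rewrite cS.
have [[C CN]|[y [q [yE q_nint]]]] := smith_dichotomy inj_N.
  rewrite -(hull_unimodular n_gt1 w_add w_translate w_SL (v ord0) CN).
  congr w; apply: eq_lattice_hull; first by rewrite enum_ordSl.
  have delta_v j : N *m delta_mx j 0 + v ord0 = v (lift ord0 j).
    by rewrite -colE; apply/matrixP => i p; rewrite ord1 !mxE subrK.
  rewrite enum_ordSl /unit_simplex /= mulmx0 add0r => t; rewrite !inE; congr (_ || _).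
  rewrite -!map_comp; congr (t \in _); apply: eq_map => j /=; by rewrite delta_v.
rewrite NE in yE.
have [l l1 [ls [x lx]]] := noninteger_barycentric yE q_nint.
exact: (@exchange_step x l).
Qed.

End Step.

Lemma hull_vanish s : W s = 0.
Proof.
have [m] := ubnP (size s); elim: m s => // m IHm s; rewrite ltnS => les.
have fewer s' : (size s' < size s)%N -> W s' = 0.
  by move=> lt; apply: IHm; apply: leq_trans lt les.
case sE : (size s) => [|k]; first by rewrite (size0nil sE) hull_nil.
rewrite sE in fewer.
have all_v (v : 'I_k.+1 -> 'cV[int]_n) : W [seq v i | i <- enum 'I_k.+1] = 0.
  have [g] := ubnP (absz (gram v)); elim: g v => // g IHg v; rewrite ltnS => leg.
  by apply: simplex_step => // v' lt; apply: IHg; apply: leq_trans lt leg.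
rewrite -(all_v (fun i => nth 0 s i)); congr w; congr lattice_hull.
by rewrite (map_comp (nth 0 s) val) val_enum_ord -sE map_nth_iota0 ?take_size.
Qed.

Lemma equivariant_additive_vanish P : w P = 0.
Proof. by have [s _ ->] := polytope_hull P; exact: hull_vanish. Qed.

End Vanishing.

Theorem theorem7 (R : realType) (n : nat) (hn : (2 <= n)%N)
    (z : lattice_polytope R n -> 'cV[R]_n) :
  [/\ SLZ_equivariant z, translation_equivariant z & minkowski_additive z] <->
  z = discrete_steiner_point.
Proof.
split=> [[zSL zT zA]|->]; last first.
  split; [exact: discrete_steiner_SLZ|exact: discrete_steiner_translation|].
  exact: discrete_steiner_additive.
apply/funext => P; apply/eqP; rewrite -subr_eq0.
pose w P := z P - discrete_steiner_point P.
rewrite -[_ - _]/(w P); apply/eqP; apply: equivariant_additive_vanish hn _ _ _ P.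
- by move=> P Q; rewrite /w zA discrete_steiner_additive opprD addrACA.
- by move=> P t; rewrite /w zT discrete_steiner_translation opprD addrACA subrr addr0.
- by move=> phi P dphi; rewrite /w zSL // discrete_steiner_SLZ // mulmxBr.
Qed.
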